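(* Let $\mathbf K$ be a fragmented AEC with the amalgamation property and with no models of cardinality $< \mathrm{LS}(\mathbf K)$. Assume that for every $\lambda \in \mathrm{dom}(\mathbf K)$, $\mathbf K$ is categorical in $\lambda$ and stable in $\lambda$. Then every $M \in \mathbf K$ with $\|M\| > \mathrm{LS}(\mathbf K)$ is model-homogeneous.
   Context: An abstract class $\mathbf K=(K,\le_{\mathbf K})$ is a class of structures in a fixed vocabulary $\tau(\mathbf K)$, closed under isomorphism, with a partial order extending substructure and invariant under isomorphism. $\mathrm{LS}(\mathbf K)$ is the least $\lambda\ge|\tau(\mathbf K)|+\aleph_0$ such that every $A\subseteq|M|$, $M\in\mathbf K$, is contained in some $M_0\le_{\mathbf K} M$ with $\|M_0\|\le|A|+\lambda$. A fragmented AEC is an abstract class with $\mathrm{LS}(\mathbf K)<\infty$ satisfying: coherence (if $|M_0|\subseteq|M_1|$, $M_0\le_{\mathbf K}M_2$, $M_1\le_{\mathbf K}M_2$ then $M_0\le_{\mathbf K}M_1$); restricted chain axiom (if $\langle M_i:i<\delta\rangle$ is increasing, $M_\delta=\bigcup_i M_i$, and $\|M_i\|=\|M_\delta\|$ for some $i<\delta$, then $M_\delta\in\mathbf K$ and $M_0\le_{\mathbf K}M_\delta$); smoothness (if $\langle M_i:i<\delta\rangle$ is increasing and $N\in\mathbf K$ with $M_i\le_{\mathbf K}N$ for all $i$, then $\bigcup_i M_i\in\mathbf K$ and $\bigcup_i M_i\le_{\mathbf K}N$). $\mathrm{dom}(\mathbf K)$ is the class of cardinals $\lambda$ with a model of cardinality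 $\lambda$. Orbital types $\mathrm{S}(M)$ over $M$: classes of triples $(b,M,N)$, $M \le_{\mathbf K} N$, $b\in |N|$, under the transitive closure of ''there are $\mathbf K$-embeddings of $N_1,N_2$ into a common model fixing $M$ and sending $b_1,b_2$ to the same element''. Stable in $\lambda$: $|\mathrm S(M)|\le\lambda$ for every $M$ of cardinality $\lambda$. Categorical in $\lambda$: exactly one model of cardinality $\lambda$ up to isomorphism. $M$ is model-homogeneous if whenever $M_0\le_{\mathbf K}N_0$, $M_0\le_{\mathbf K}M$ and $\|N_0\|<\|M\|$, there is a $\mathbf K$-embedding $N_0\to M$ fixing $M_0$. *)

(* Defs.v *)
From Stdlib Require Import Relations.Relation_Operators.

Set Implicit Arguments.

Definition card_le (A B : Type) : Prop :=
  exists f : A -> B, forall x y, f x = f y -> x = y.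
Definition card_lt (A B : Type) : Prop := card_le A B /\ ~ card_le B A.
Definition card_eq (A B : Type) : Prop :=
  exists f : A -> B, (forall x y, f x = f y -> x = y) /\ (forall y, exists x, f x = y).

Record vocab := Vocab {
  fsym : Type; farity : fsym -> nat;
  rsym : Type; rarity : rsym -> nat }.

Definition Fin (n : nat) : Type := { i : nat | i < n }.

(* A structure whose universe is a subset [mdom] of an ambient type [T].
   Interpretations are total on [T]; only their behaviour on [mdom] matters
   (all notions below are insensitive to the values outside [mdom]). *)
Record model (tau : vocab) (T : Type) := Model {
  mdom : T -> Prop;
  mfun : forall f : fsym tau, (Fin (farity tau f) -> T) -> T;
  mrel : forall r : rsym tau, (Fin (rarity tau r) -> T) -> Prop;
  mclosed : forall f args, (forall i, mdom (args i)) -> mdom (mfun f args) }.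

Arguments mdom {tau T}.
Arguments mfun {tau T}.
Arguments mrel {tau T}.

Definition carrier {tau T} (M : model tau T) : Type := { x : T | mdom M x }.

Definition substr {tau T} (M N : model tau T) : Prop :=
  (forall x, mdom M x -> mdom N x) /\
  (forall f args, (forall i, mdom M (args i)) -> mfun M f args = mfun N f args) /\
  (forall r args, (forall i, mdom M (args i)) -> (mrel M r args <-> mrel N r args)).

Definition embedding {tau T T'} (h : T -> T') (M : model tau T) (N : model tau T') : Prop :=
  (forall x, mdom M x -> mdom N (h x)) /\
  (forall x y, mdom M x -> mdom M y -> h x = h y -> x = y) /\
  (forall f args, (forall i, mdom M (args i)) ->
     h (mfun M f args) = mfun N f (fun i => h (args i))) /\
  (forall r args, (forall i, mdom M (args i)) ->
     (mrel M r args <-> mrel N r (fun i => h (args i)))).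

Definition isomorphism {tau T T'} (h : T -> T') (M : model tau T) (N : model tau T') : Prop :=
  embedding h M N /\ (forall y, mdom N y -> exists x, mdom M x /\ h x = y).

Definition image_dom {tau T T'} (h : T -> T') (M : model tau T) (M' : model tau T') : Prop :=
  forall y, mdom M' y <-> exists x, mdom M x /\ h x = y.

Record aclass (tau : vocab) := AClass {
  Kmem : forall T, model tau T -> Prop;
  Kle : forall T, model tau T -> model tau T -> Prop }.

Arguments Kmem {tau} _ {T}.
Arguments Kle {tau} _ {T}.

Definition is_abstract_class {tau} (K : aclass tau) : Prop :=
  (forall T T' (M : model tau T) (N : model tau T') h,
      Kmem K M -> isomorphism h M N -> Kmem K N) /\
  (forall T (M N : model tau T), Kle K M N -> Kmem K M /\ Kmem K N) /\
  (forall T (M : model tau T), Kmem K M -> Kle K M M) /\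
  (forall T (M N P : model tau T), Kle K M N -> Kle K N P -> Kle K M P) /\
  (forall T (M N : model tau T), Kle K M N -> Kle K N M -> substr M N /\ substr N M) /\
  (forall T (M N : model tau T), Kle K M N -> substr M N) /\
  (forall T T' (M N : model tau T) (M' N' : model tau T') h,
      Kle K M N -> isomorphism h N N' -> image_dom h M M' -> substr M' N' ->
      Kle K M' N').

Definition Kemb {tau} (K : aclass tau) {T T'} (h : T -> T')
    (M : model tau T) (N : model tau T') : Prop :=
  Kmem K M /\ embedding h M N /\
  exists M' : model tau T', image_dom h M M' /\ substr M' N /\ Kle K M' N.

Definition LS_prop {tau} (K : aclass tau) (L : Type) : Prop :=
  card_le ((fsym tau + rsym tau) + nat)%type L /\
  forall T (M : model tau T) (A : T -> Prop),
    Kmem K M -> (forall x, A x -> mdom M x) ->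
    exists M0 : model tau T, Kle K M0 M /\ (forall x, A x -> mdom M0 x) /\
      card_le (carrier M0) ({x : T | A x} + L)%type.

Definition is_LS {tau} (K : aclass tau) (L : Type) : Prop :=
  LS_prop K L /\ forall L' : Type, LS_prop K L' -> card_le L L'.

(* an ordinal is represented by a (strictly) well-ordered type *)
Definition well_order {I : Type} (lt : I -> I -> Prop) : Prop :=
  (forall i, ~ lt i i) /\ (forall i j k, lt i j -> lt j k -> lt i k) /\
  (forall i j, lt i j \/ i = j \/ lt j i) /\ well_founded lt.

Definition limit_order {I : Type} (lt : I -> I -> Prop) : Prop :=
  well_order lt /\ (exists i : I, True) /\ (forall i, exists j, lt i j).

Definition increasing {tau} (K : aclass tau) {T I} (lt : I -> I -> Prop)
    (M : I -> model tau T) : Prop :=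
  forall i j, lt i j -> Kle K (M i) (M j).

Definition is_union {tau T I} (M : I -> model tau T) (U : model tau T) : Prop :=
  (forall x, mdom U x <-> exists i, mdom (M i) x) /\ (forall i, substr (M i) U).

Definition coherence {tau} (K : aclass tau) : Prop :=
  forall T (M0 M1 M2 : model tau T),
    (forall x, mdom M0 x -> mdom M1 x) -> Kle K M0 M2 -> Kle K M1 M2 -> Kle K M0 M1.

Definition restricted_chain {tau} (K : aclass tau) : Prop :=
  forall T (I : Type) (lt : I -> I -> Prop) (M : I -> model tau T) (U : model tau T),
    limit_order lt -> increasing K lt M -> is_union M U ->
    (exists i, card_eq (carrier (M i)) (carrier U)) ->
    Kmem K U /\ (forall i0, (forall j, ~ lt j i0) -> Kle K (M i0) U).

Definition smoothness {tau} (K : aclass tau) : Prop :=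
  forall T (I : Type) (lt : I -> I -> Prop) (M : I -> model tau T) (U N : model tau T),
    limit_order lt -> increasing K lt M -> is_union M U ->
    Kmem K N -> (forall i, Kle K (M i) N) ->
    Kmem K U /\ Kle K U N.

Definition fragmented_AEC {tau} (K : aclass tau) : Prop :=
  is_abstract_class K /\ (exists L : Type, LS_prop K L) /\
  coherence K /\ restricted_chain K /\ smoothness K.

Definition amalgamation {tau} (K : aclass tau) : Prop :=
  forall T (M0 M1 M2 : model tau T), Kle K M0 M1 -> Kle K M0 M2 ->
    exists T' (N : model tau T') (f1 f2 : T -> T'),
      Kemb K f1 M1 N /\ Kemb K f2 M2 N /\ (forall x, mdom M0 x -> f1 x = f2 x).

Definition in_dom {tau} (K : aclass tau) (lam : Type) : Prop :=
  exists T (M : model tau T), Kmem K M /\ card_eq (carrier M) lam.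

Definition categorical {tau} (K : aclass tau) (lam : Type) : Prop :=
  (exists T (M : model tau T), Kmem K M /\ card_eq (carrier M) lam) /\
  (forall T T' (M : model tau T) (N : model tau T'),
     Kmem K M -> Kmem K N -> card_eq (carrier M) lam -> card_eq (carrier N) lam ->
     exists h : T -> T', isomorphism h M N).

(* triples (b, M, N) with M <=_K N, with N allowed in any ambient type:
   the inclusion of M is represented by a K-embedding gf of M into gN *)
Record gtriple {tau} (K : aclass tau) {T} (M : model tau T) := GTriple {
  gT : Type;
  gN : model tau gT;
  gf : T -> gT;
  gb : gT;
  gf_K : Kemb K gf M gN;
  gb_in : mdom gN gb }.

Arguments gT {tau K T M}.
Arguments gN {tau K T M}.
Arguments gf {tau K T M}.
Arguments gb {tau K T M}.

Definition gatomic {tau} (K : aclass tau) {T} (M : model tau T) (p q : gtriple K M) : Prop :=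
  exists T3 (N3 : model tau T3) (g1 : gT p -> T3) (g2 : gT q -> T3),
    Kemb K g1 (gN p) N3 /\ Kemb K g2 (gN q) N3 /\
    (forall x, mdom M x -> g1 (gf p x) = g2 (gf q x)) /\ g1 (gb p) = g2 (gb q).

(* equality of orbital types: transitive closure of the atomic relation *)
Definition gequiv {tau} (K : aclass tau) {T} (M : model tau T) : gtriple K M -> gtriple K M -> Prop :=
  clos_trans _ (@gatomic tau K T M).

Definition stable {tau} (K : aclass tau) (lam : Type) : Prop :=
  forall T (M : model tau T), Kmem K M -> card_eq (carrier M) lam ->
    exists (I : Type) (fam : I -> gtriple K M),
      card_le I lam /\ forall t : gtriple K M, exists i, @gequiv tau K T M (fam i) t.

(* model-homogeneity: for M0 <=_K M and M0 <=_K N0 (the latter inclusion given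
   by a K-embedding h) with ||N0|| < ||M||, N0 K-embeds into M over M0 *)
Definition model_homogeneous {tau} (K : aclass tau) {T} (M : model tau T) : Prop :=
  forall (M0 : model tau T) T' (N0 : model tau T') (h : T -> T'),
    Kle K M0 M -> Kemb K h M0 N0 -> card_lt (carrier N0) (carrier M) ->
    exists g : T' -> T, Kemb K g N0 M /\ (forall x, mdom M0 x -> g (h x) = x).

(* Main.v *)
(* Let S be the size of M and A < S the size of N0. In the restricted chain axiom
   unions are available only for chains of models of constant size, so a saturated
   model of size S is built from a chain of models of size S, each realizing all
   types over the previous ones (stability in S), whose length has cofinality
   above A. Every submodel of size A of the union lies in some member of the
   chain, so all types over it are realized; by categoricity M is this model. A
   chain of length A of partial embeddings between models of size A, growing by
   one element of N0 at a time, then embeds N0 into M over M0.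
   To compare extensions inside one type, all models of size at most S are moved
   into the ambient type S -> Prop, where any S points leave S points unused. *)

From Stdlib Require Import Relations.Relation_Operators Classical ClassicalEpsilon
  FunctionalExtensionality ProofIrrelevance Arith Lia.
From Stdlib Require Cantor.
From mathcomp Require boolp classical_sets wochoice.
Require Import Defs.

Set Implicit Arguments.
Set Bullet Behavior "Strict Subproofs".

(** * Cardinals *)

(** Saturation is demanded only for the single size [A] of the given [N0], and the saturated model
    is built anew for each [A]. A chain whose order type is the successor cardinal of [A] is then
    long enough; it has at most [S] members because [A < S], so a singular [S] causes no trouble.
    Everything happens in just two sizes: the saturated model is built in size [S], the embedding in
    size [A]. Since [A] is at least the Löwenheim-Skolem number, any set of at most [A] points of a
    large enough model lies in a submodel of size exactly [A]. Amalgams, whose size is not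
    controlled, are cut back in this way after each use, so that all chains keep a constant size and
    their unions remain available. *)

Lemma zorn_preorder (X : Type) (x0 : X) (R : X -> X -> Prop) :
  (forall x, R x x) -> (forall x y z, R x y -> R y z -> R x z) ->
  (forall C : X -> Prop, (forall x y, C x -> C y -> R x y \/ R y x) ->
     (exists x, C x) -> exists u, forall x, C x -> R x u) ->
  exists m, forall x, R m x -> R x m.
Proof.
  intros Rr Rt Rc.
  assert (E : forall x y, is_true (boolp.asbool (R x y)) <-> R x y).
  { intros x y. rewrite boolp.asboolE. tauto. }
  destruct (@classical_sets.ZL_preorder X x0 (fun x y => boolp.asbool (R x y)))
    as [m Hm].
  - intros x. apply E. auto.
  - intros x y z H1 H2. apply E. apply E in H1, H2. eauto.
  - intros C HC. destruct (classic (exists x, C x)) as [Hne|Hemp].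
    + destruct (Rc C) as [u Hu]; auto.
      * intros x y Cx Cy. destruct (HC x y Cx Cy) as [H|H]; apply E in H; auto.
      * exists u. intros x Cx. apply E. auto.
    + exists x0. intros x Cx. exfalso. eauto.
  - exists m. intros x H. apply E. apply Hm. apply E. auto.
Qed.

Lemma sig_ext (T : Type) (P : T -> Prop) (x y : {x | P x}) :
  proj1_sig x = proj1_sig y -> x = y.
Proof.
  destruct x as [x px], y as [y py]; cbn; intros ->. f_equal. apply proof_irrelevance.
Qed.

Lemma card_le_refl (A : Type) : card_le A A.
Proof. exists (fun x => x). auto. Qed.

Lemma card_le_trans (A B C : Type) : card_le A B -> card_le B C -> card_le A C.
Proof. intros [f Hf] [g Hg]. exists (fun x => g (f x)). auto. Qed.

Lemma card_eq_le (A B : Type) : card_eq A B -> card_le A B.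
Proof. intros [f [Hf _]]. exists f. auto. Qed.

Lemma card_le_rel (A B : Type) (R : A -> B -> Prop) :
  (forall a, exists b, R a b) -> (forall a a' b, R a b -> R a' b -> a = a') ->
  card_le A B.
Proof.
  intros Ht Hi. exists (fun a => proj1_sig (constructive_indefinite_description _ (Ht a))).
  intros x y E.
  destruct (constructive_indefinite_description _ (Ht x)),
    (constructive_indefinite_description _ (Ht y)); cbn in E; subst; eauto.
Qed.

Lemma card_eq_rel (A B : Type) (R : A -> B -> Prop) :
  (forall a, exists b, R a b) -> (forall b, exists a, R a b) ->
  (forall a a' b, R a b -> R a' b -> a = a') ->
  (forall a b b', R a b -> R a b' -> b = b') ->
  card_eq A B.
Proof.
  intros Ht Hs Hi Hf.
  exists (fun a => proj1_sig (constructive_indefinite_description _ (Ht a))). split.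
  - intros x y E.
    destruct (constructive_indefinite_description _ (Ht x)),
      (constructive_indefinite_description _ (Ht y)); cbn in E; subst; eauto.
  - intros b. destruct (Hs b) as [a Ha]. exists a.
    destruct (constructive_indefinite_description _ (Ht a)); cbn; eauto.
Qed.

Lemma card_eq_sym (A B : Type) : card_eq A B -> card_eq B A.
Proof.
  intros [f [Hi Hs]]. apply (@card_eq_rel _ _ (fun b a => f a = b)); auto.
  - intros a; eauto.
  - intros; subst; auto.
  - intros; subst; auto.
Qed.

Lemma card_eq_trans (A B C : Type) : card_eq A B -> card_eq B C -> card_eq A C.
Proof.
  intros [f [Hi Hs]] [g [Hi' Hs']]. exists (fun x => g (f x)). split; auto.
  intros c. destruct (Hs' c) as [b <-]. destruct (Hs b) as [a <-]. eauto.
Qed.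

(** [C] consists of the points reached by iterating [g] after [f] from points outside the range of
    [g]. The bijection is [f] on [C] and the inverse of [g] off [C]. *)
Lemma cantor_bernstein (A B : Type) : card_le A B -> card_le B A -> card_eq A B.
Proof.
  intros [f Hf] [g Hg].
  set (C := fun x => exists n y, (forall b, g b <> y) /\ Nat.iter n (fun z => g (f z)) y = x).
  assert (CS : forall x, C x -> C (g (f x))).
  { intros x [n [y [Hy E]]]. exists (S n), y. split; [auto|]. cbn. unfold Nat.iter in E. rewrite E. auto. }
  assert (CP : forall b, C (g b) -> exists a, C a /\ f a = b).
  { intros b [n [y [Hy E]]]. destruct n as [|n]; cbn in E.
    - subst. destruct (Hy b); auto.
    - apply Hg in E. eexists. split; [|exact E]. exists n, y. split; auto. }
  apply (@card_eq_rel _ _ (fun a b => (C a /\ f a = b) \/ (~ C a /\ a = g b))).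
  - intros a. destruct (classic (C a)) as [Ca|Ca]; [eauto|].
    destruct (classic (exists b, g b = a)) as [[b <-]|H]; [eauto|].
    destruct Ca. exists 0, a. split; auto. intros b Hb; eauto.
  - intros b. destruct (classic (C (g b))) as [Cb|Cb]; [|eauto].
    destruct (CP _ Cb) as [a Ha]. eauto.
  - intros a a' b [[Ca E]|[Ca E]] [[Ca' E']|[Ca' E']]; subst; auto.
    + destruct Ca'. auto.
    + destruct Ca. auto.
  - intros a b b' [[Ca E]|[Ca E]] [[Ca' E']|[Ca' E']]; subst; auto; tauto.
Qed.

Lemma card_le_total (A B : Type) : card_le A B \/ card_le B A.
Proof.
  set (pinj := fun P : A -> B -> Prop =>
    (forall a b b', P a b -> P a b' -> b = b') /\ (forall a a' b, P a b -> P a' b -> a = a')).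
  assert (H0 : pinj (fun _ _ => False)) by (split; tauto).
  destruct (@zorn_preorder {P | pinj P} (exist _ _ H0)
    (fun P Q => forall a b, proj1_sig P a b -> proj1_sig Q a b)) as [[m [m1 m2]] Hm]; auto.
  - intros C HC _.
    assert (HU : pinj (fun a b => exists P, C P /\ proj1_sig P a b)).
    { split.
      - intros a b b' [P [CP p]] [Q [CQ q]].
        destruct (HC P Q CP CQ) as [H|H]; apply H in p || apply H in q.
        + destruct Q as [Q [Q1 Q2]]; cbn in *; eauto.
        + destruct P as [P [P1 P2]]; cbn in *; eauto.
      - intros a a' b [P [CP p]] [Q [CQ q]].
        destruct (HC P Q CP CQ) as [H|H]; apply H in p || apply H in q.
        + destruct Q as [Q [Q1 Q2]]; cbn in *; eauto.
        + destruct P as [P [P1 P2]]; cbn in *; eauto. }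
    exists (exist _ _ HU). cbn. eauto.
  - cbn in Hm.
    destruct (classic (forall a, exists b, m a b)) as [Ha|Ha].
    { left. eapply card_le_rel; eauto. }
    destruct (classic (forall b, exists a, m a b)) as [Hb|Hb].
    { right. apply (@card_le_rel _ _ (fun b a => m a b)); eauto. }
    exfalso. apply not_all_ex_not in Ha as [a Ha]. apply not_all_ex_not in Hb as [b Hb].
    assert (HU : pinj (fun x y => m x y \/ (x = a /\ y = b))).
    { split; intros x y z [H|[-> ->]] [H'|[? ?]]; subst; eauto; exfalso; eauto. }
    apply Ha. exists b. apply (Hm (exist _ _ HU)); cbn; auto.
Qed.

(** Maps between models are total functions on ambient types, so an injection of subtypes has to be
    extended; outside [P] it takes the arbitrary value [d]. *)
Lemma card_le_fun (T T' : Type) (P : T -> Prop) (Q : T' -> Prop) :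
  inhabited T' -> card_le {x | P x} {y | Q y} ->
  exists j : T -> T', (forall x, P x -> Q (j x)) /\
    (forall x y, P x -> P y -> j x = j y -> x = y).
Proof.
  intros [d] [f Hf].
  exists (fun x => match excluded_middle_informative (P x) with
    | left p => proj1_sig (f (exist _ x p)) | right _ => d end).
  split.
  - intros x p. destruct (excluded_middle_informative (P x)); [|tauto].
    apply proj2_sig.
  - intros x y p q.
    destruct (excluded_middle_informative (P x)), (excluded_middle_informative (P y)); try tauto.
    intros E. apply sig_ext in E. apply Hf in E. inversion E; auto.
Qed.

Lemma card_le_prod (A B C D : Type) : card_le A C -> card_le B D -> card_le (A * B) (C * D).
Proof.
  intros [f Hf] [g Hg]. exists (fun p => (f (fst p), g (snd p))).
  intros [a b] [c d] E. cbn in E. inversion E. f_equal; auto.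
Qed.

Lemma card_le_sum (A B C D : Type) : card_le A C -> card_le B D -> card_le (A + B) (C + D).
Proof.
  intros [f Hf] [g Hg].
  exists (fun p => match p with inl a => inl (f a) | inr b => inr (g b) end).
  intros [a|a] [b|b] E; inversion E; f_equal; auto.
Qed.

Lemma card_le_sum_prod (A : Type) : card_le nat A -> card_le (A + A) (A * A).
Proof.
  intros [e He].
  exists (fun p => match p with inl a => (e 0, a) | inr a => (e 1, a) end).
  intros [a|a] [b|b] E; inversion E; auto; apply He in H0; discriminate.
Qed.

(* A maximal partial pairing f : D x D -> D satisfies
   |D| = |A|: otherwise a copy E = j(D) of D fits in the complement of D, and
   the new pairs of (D \/ E)^2 can be injected into E. *)
Lemma card_square (A : Type) : card_le nat A -> card_le (A * A) A.
Proof.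
  intros [e He].
  set (ok := fun p : (A -> Prop) * (A -> A -> A) =>
    (forall n, fst p (e n)) /\
    (forall x y, fst p x -> fst p y -> fst p (snd p x y)) /\
    (forall x y x' y', fst p x -> fst p y -> fst p x' -> fst p y' ->
       snd p x y = snd p x' y' -> x = x' /\ y = y')).
  set (ei := fun x => epsilon (inhabits 0) (fun n => e n = x)).
  assert (eiK : forall n, ei (e n) = n).
  { intros n. apply He. apply (epsilon_spec (inhabits 0) (fun k => e k = e n)). eauto. }
  assert (Hpr : exists pr : nat -> nat -> nat,
    forall a b c d, pr a b = pr c d -> a = c /\ b = d).
  { exists (fun a b => Cantor.to_nat (a, b)). intros a b c d E.
    apply (f_equal Cantor.of_nat) in E. rewrite !Cantor.cancel_of_to in E.
    inversion E; auto. }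
  destruct Hpr as [pr Hpr].
  (* Cantor pairing, carried to the range of [e], is the starting point for Zorn's lemma. Every
     admissible domain contains this range and so is infinite. *)
  assert (H0 : ok ((fun x => exists n, e n = x), (fun x y => e (pr (ei x) (ei y))))).
  { split; [|split]; cbn; [eauto|eauto|].
    intros x y x' y' [a <-] [b <-] [c <-] [d <-] E. rewrite !eiK in E.
    apply He, Hpr in E as [-> ->]. auto. }
  destruct (@zorn_preorder {p | ok p} (exist _ _ H0) (fun p q =>
    (forall x, fst (proj1_sig p) x -> fst (proj1_sig q) x) /\
    (forall x y, fst (proj1_sig p) x -> fst (proj1_sig p) y ->
       snd (proj1_sig p) x y = snd (proj1_sig q) x y))) as [[[D f] [m1 [m2 m3]]] Hm].
  - auto.
  - intros p q r [H1 H2] [H3 H4]. split; auto. intros x y Hx Hy. rewrite H2; auto.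
  - intros C HC [p0 Cp0].
    set (D := fun x => exists p, C p /\ fst (proj1_sig p) x).
    assert (Dd : forall x y, D x -> D y -> exists p, C p /\ fst (proj1_sig p) x /\ fst (proj1_sig p) y).
    { intros x y [p [Cp px]] [q [Cq qy]]. destruct (HC p q Cp Cq) as [[H _]|[H _]]; eauto. }
    set (g := fun x y => epsilon (inhabits x) (fun z => exists p, C p /\
       fst (proj1_sig p) x /\ fst (proj1_sig p) y /\ z = snd (proj1_sig p) x y)).
    assert (gE : forall p x y, C p -> fst (proj1_sig p) x -> fst (proj1_sig p) y ->
       snd (proj1_sig p) x y = g x y).
    { intros p x y Cp px py.
      destruct (epsilon_spec (inhabits x) (fun z => exists p, C p /\
       fst (proj1_sig p) x /\ fst (proj1_sig p) y /\ z = snd (proj1_sig p) x y)) as [q [Cq [qx [qy E]]]].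
      - eauto 7.
      - fold (g x y) in E. rewrite E.
        destruct (HC p q Cp Cq) as [[_ H]|[_ H]]; [|symmetry]; apply H; auto. }
    assert (HU : ok (D, g)).
    { split; [|split]; cbn.
      - intros n. exists p0. split; auto. apply (proj2_sig p0).
      - intros x y Dx Dy. destruct (Dd x y Dx Dy) as [p [Cp [px py]]].
        exists p. split; auto. rewrite <- (gE p); auto. apply (proj2_sig p); auto.
      - intros x y x' y' Dx Dy Dx' Dy' E.
        destruct (Dd x y Dx Dy) as [p [Cp [px py]]].
        destruct (Dd x' y' Dx' Dy') as [q [Cq [qx qy]]].
        rewrite <- (gE p), <- (gE q) in E; auto.
        destruct (HC p q Cp Cq) as [[H1 H2]|[H1 H2]].
        + rewrite H2 in E; auto. apply (proj2_sig q); auto.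
        + rewrite H2 in E; auto. apply (proj2_sig p); auto. }
    exists (exist _ _ HU). intros p Cp. cbn. split; [intros x px; exists p; auto|auto].
  - cbn in *.
    assert (DD : card_le ({x | D x} * {x | D x}) {x | D x}).
    { exists (fun p => exist _ (f (proj1_sig (fst p)) (proj1_sig (snd p)))
        (m2 _ _ (proj2_sig (fst p)) (proj2_sig (snd p)))).
      intros [[x px] [y py]] [[x' px'] [y' py']] E. cbn in E.
      inversion E as [E']. apply m3 in E'; auto. destruct E'; subst.
      f_equal; apply sig_ext; auto. }
    assert (ND : card_le nat {x | D x}).
    { exists (fun n => exist _ (e n) (m1 n)). intros x y E. inversion E; auto. }
    destruct (card_le_total {x | ~ D x} {x | D x}) as [Hc|Hc].
    + assert (AD : card_le A {x | D x}).
      { eapply card_le_trans; [|exact DD].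
        eapply card_le_trans; [|apply card_le_sum_prod; exact ND].
        eapply card_le_trans; [|apply card_le_sum; [apply card_le_refl|exact Hc]].
        apply (@card_le_rel _ _ (fun a s => match s with inl d => proj1_sig d = a
          | inr d => proj1_sig d = a end)).
        - intros a. destruct (classic (D a)) as [d|d].
          + exists (inl (exist _ a d)). auto.
          + exists (inr (exist _ a d)). auto.
        - intros a a' [b|b]; congruence. }
      eapply card_le_trans; [apply card_le_prod; exact AD|].
      eapply card_le_trans; [exact DD|]. exists (@proj1_sig _ _). intros; apply sig_ext; auto.
    + exfalso. destruct (card_le_fun _ _ (inhabits (e 0)) Hc) as [j [j1 j2]].
      set (ji := fun x => epsilon (inhabits (e 0)) (fun y => D y /\ j y = x)).
      assert (jiK : forall x, D x -> ji (j x) = x).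
      { intros x Dx. destruct (epsilon_spec (inhabits (e 0)) (fun y => D y /\ j y = j x)) as [H1 H2].
        - eauto.
        - apply j2; auto. }
      set (D' := fun x => D x \/ exists y, D y /\ j y = x).
      (* [c] injects the enlarged domain [D'] back into [D]: the first coordinates [e 0] and [e 1]
         record whether a point lies in [D] or in its copy. *)
      set (c := fun x => if excluded_middle_informative (D x) then f (e 0) x else f (e 1) (ji x)).
      assert (Dc : forall x, D' x -> D (c x)).
      { intros x [Dx|[y [Dy <-]]]; unfold c.
        - destruct (excluded_middle_informative (D x)); [auto|tauto].
        - destruct (excluded_middle_informative (D (j y))); [destruct (j1 y); auto|].
          rewrite jiK; auto. }
      assert (ci : forall x y, D' x -> D' y -> c x = c y -> x = y).
      { intros x y Hx Hy. unfold c.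
        destruct (excluded_middle_informative (D x)) as [Dx|Dx],
         (excluded_middle_informative (D y)) as [Dy|Dy].
        - intros E. apply m3 in E as [_ E]; auto.
        - destruct Hy as [|[y' [Dy' <-]]]; [tauto|]. rewrite jiK; auto.
          intros E. apply m3 in E as [E _]; auto. apply He in E. discriminate.
        - destruct Hx as [|[x' [Dx' <-]]]; [tauto|]. rewrite jiK; auto.
          intros E. apply m3 in E as [E _]; auto. apply He in E. discriminate.
        - destruct Hx as [|[x' [Dx' <-]]]; [tauto|].
          destruct Hy as [|[y' [Dy' <-]]]; [tauto|]. rewrite !jiK; auto.
          intros E. apply m3 in E as [_ E]; auto. congruence. }
      set (f' := fun x y => if excluded_middle_informative (D x /\ D y) then f x y
         else j (f (c x) (c y))).
      assert (HU : ok (D', f')).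
      { split; [|split]; cbn.
        - left; auto.
        - intros x y Dx Dy. unfold f'.
          destruct (excluded_middle_informative (D x /\ D y)); [left; apply m2; tauto|].
          right. exists (f (c x) (c y)). auto.
        - intros x y x' y' Dx Dy Dx' Dy'. unfold f'.
          destruct (excluded_middle_informative (D x /\ D y)) as [[H1 H2]|_],
            (excluded_middle_informative (D x' /\ D y')) as [[H3 H4]|_]; intros E.
          + apply m3 in E; auto.
          + exfalso. apply (j1 (f (c x') (c y'))); auto. rewrite <- E; auto.
          + exfalso. apply (j1 (f (c x) (c y))); auto. rewrite E; auto.
          + apply j2 in E; auto. apply m3 in E as [E1 E2]; auto. }
      destruct (Hm (exist _ _ HU)) as [Hm1 _]; cbn in *.
      * split; [left; auto|]. intros x y Hx Hy. unfold f'.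
        destruct (excluded_middle_informative (D x /\ D y)); tauto.
      * apply (j1 (e 0)); auto. apply Hm1. right; eauto.
Qed.

Lemma card_le_sum_idem (A : Type) : card_le nat A -> card_le (A + A) A.
Proof. intros H. eapply card_le_trans; [apply card_le_sum_prod|apply card_square]; auto. Qed.

(** A point is coded by the index of a member containing it together with its code in that member;
    such pairs live in [S * S]. *)
Lemma card_le_bigcup (S T I : Type) (D : T -> Prop) (E : I -> T -> Prop) :
  card_le nat S -> card_le I S -> (forall i, card_le {x | E i x} S) ->
  (forall x, D x -> exists i, E i x) -> card_le {x | D x} S.
Proof.
  intros NS [k Hk] HE HD.
  eapply card_le_trans; [|apply card_square; exact NS].
  apply (@card_le_rel _ _ (fun x p => exists i (q : E i (proj1_sig x)), fst p = k i /\
     snd p = proj1_sig (constructive_indefinite_description _ (HE i)) (exist _ _ q))).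
  - intros [x Dx]. destruct (HD x Dx) as [i Ei]. exists (k i, proj1_sig
     (constructive_indefinite_description _ (HE i)) (exist _ x Ei)). cbn. eauto.
  - intros [x px] [y py] [a b] [i [q [E1 E2]]] [i' [q' [E1' E2']]]. cbn in *. subst.
    apply Hk in E1'. subst i'. apply sig_ext. cbn.
    destruct (constructive_indefinite_description _ (HE i)) as [h Hh]; cbn in *.
    apply Hh in E2'. inversion E2'; auto.
Qed.

Lemma card_le_subset (T : Type) (P Q : T -> Prop) :
  (forall x, P x -> Q x) -> card_le {x | P x} {x | Q x}.
Proof.
  intros H. exists (fun x => exist _ (proj1_sig x) (H _ (proj2_sig x))).
  intros x y E. inversion E. apply sig_ext; auto.
Qed.

Lemma card_le_union (S T : Type) (P Q : T -> Prop) :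
  card_le nat S -> card_le {x | P x} S -> card_le {x | Q x} S ->
  card_le {x | P x \/ Q x} S.
Proof.
  intros NS HP HQ.
  apply (@card_le_bigcup S T bool _ (fun b x => if b then P x else Q x)); auto.
  - eapply card_le_trans; [|exact NS]. exists (fun b : bool => if b then 0 else 1).
    intros [] []; congruence.
  - intros []; auto.
  - intros x [|]; [exists true|exists false]; auto.
Qed.

Lemma card_le_singleton (S T : Type) (z : T) : card_le nat S -> card_le {x | x = z} S.
Proof.
  intros [e _]. exists (fun _ => e 0). intros [x hx] [y hy] _. apply sig_ext. cbn. congruence.
Qed.

Lemma card_le_image (A T : Type) (f : A -> T) : card_le {x | exists a, f a = x} A.
Proof.
  apply (@card_le_rel _ _ (fun x a => f a = proj1_sig x)).
  - intros [x [a <-]]. exists a. auto.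
  - intros. apply sig_ext. congruence.
Qed.

Lemma cantor_not_le (S : Type) : ~ card_le (S -> Prop) S.
Proof.
  intros [f Hf].
  set (D := fun s => exists P, f P = s /\ ~ P s).
  assert (HD : ~ D (f D)).
  { intros H. pose proof H as [P [E nP]]. apply Hf in E. subst. auto. }
  apply HD. exists D. auto.
Qed.

(** This is the space needed by [Kemb_inclusion]: around a model of size at most [S] placed in [U]
    there remain enough fresh points for any extension of size [S]. *)
Definition roomy (S U : Type) : Prop :=
  forall D : U -> Prop, card_le {x | D x} S -> card_le S {x | ~ D x}.

(** If the complement had size at most [S], the power set would be a union of two sets of size at
    most [S], against Cantor. *)
Lemma power_roomy (S : Type) : card_le nat S -> roomy S (S -> Prop).
Proof.
  intros NS D HD. destruct (card_le_total S {x | ~ D x}) as [|H]; auto.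
  exfalso. apply (@cantor_not_le S).
  eapply card_le_trans; [|apply (card_le_union _ _ NS HD H)].
  exists (fun x => exist _ x (classic (D x))). intros x y E. inversion E; auto.
Qed.

(** [Peq] carries the boolean well-ordering theorem from types with decidable equality to [S]. The
    order axioms are read off from least elements of sets of at most three points, well-foundedness
    from a least inaccessible point; the strict part is then taken. *)
Lemma well_order_exists (S : Type) : exists lt : S -> S -> Prop, well_order lt.
Proof.
  assert (W : exists R : S -> S -> bool, wochoice.well_order R).
  { revert S. refine (@boolp.Peq (fun S => exists R : S -> S -> bool, wochoice.well_order R) _).
    intros E. destruct (wochoice.well_ordering_principle E) as [R HR]. eauto. }
  destruct W as [R HR].
  assert (AE : forall P, is_true (boolp.asbool P) <-> P).
  { intros P. rewrite boolp.asboolE. tauto. }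
  assert (P : forall A : S -> Prop, (exists x, A x) ->
     exists z, A z /\ (forall x, A x -> R z x = true) /\
       forall z', A z' -> (forall x, A x -> R z' x = true) -> z = z').
  { intros A [x Ax].
    destruct (HR (fun x => boolp.asbool (A x))) as [z [[z1 z2] z3]].
    - exists x. apply (AE (A x)). auto.
    - exists z. split; [exact (proj1 (AE (A z)) z1)|]. split.
      + intros y Ay. exact (z2 y (proj2 (AE (A y)) Ay)).
      + intros z' Az' Hz'. apply z3. split; [exact (proj2 (AE (A z')) Az')|].
        intros y Hy. apply Hz'. exact (proj1 (AE (A y)) Hy). }
  assert (Rxx : forall x, R x x = true).
  { intros x. destruct (P (fun y => y = x)) as [z [-> [H _]]]; eauto. }
  assert (Rtot : forall x y, R x y = true \/ R y x = true).
  { intros x y. destruct (P (fun z => z = x \/ z = y)) as [z [[->| ->] [H _]]]; eauto. }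
  assert (Ranti : forall x y, R x y = true -> R y x = true -> x = y).
  { intros x y H1 H2. destruct (P (fun z => z = x \/ z = y)) as [z [_ [_ H]]]; eauto.
    transitivity z; [symmetry|]; apply H; auto; intros u [->| ->]; auto. }
  assert (wf : well_founded (fun x y => R x y = true /\ x <> y)).
  { intros x. apply NNPP. intros Hx.
    destruct (P (fun z => ~ Acc (fun x y => R x y = true /\ x <> y) z)) as [z [Hz [H1 _]]]; eauto.
    apply Hz. constructor. intros y [Ryz ne]. apply NNPP. intros Hy.
    apply ne. apply Ranti; auto. }
  exists (fun x y => R x y = true /\ x <> y). split; [|split; [|split]]; auto.
  - intros i [_ H]; auto.
  - intros i j k [H1 n1] [H2 n2].
    assert (H : R i k = true).
    { destruct (P (fun z => z = i \/ z = j \/ z = k)) as [z [[->|[->| ->]] [H _]]]; eauto.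
      - assert (E : i = j) by (apply Ranti; auto). tauto.
      - assert (E : j = k) by (apply Ranti; auto). tauto. }
    split; auto. intros <-. apply n1. apply Ranti; auto.
  - intros i j. destruct (classic (i = j)); auto. destruct (Rtot i j); auto.
Qed.
(** * Transfinite chains *)

Lemma sub_well_order (I : Type) (lt : I -> I -> Prop) (P : I -> Prop) :
  well_order lt -> well_order (fun x y : {i | P i} => lt (proj1_sig x) (proj1_sig y)).
Proof.
  intros [H1 [H2 [H3 H4]]]. split; [|split; [|split]].
  - intros i. apply H1.
  - intros i j k. apply H2.
  - intros i j. destruct (H3 (proj1_sig i) (proj1_sig j)) as [H|[H|H]]; auto.
    right; left; apply sig_ext; auto.
  - intros [i p]. revert p. induction (H4 i) as [i _ IH]. intros p. constructor.
    intros [j q] Hj. apply IH. exact Hj.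
Qed.

(** The index order is empty, has a last element, or is a limit. The first two cases are bounded by
    [x0] and by the last member. *)
Lemma chain_bound (X : Type) (R : X -> X -> Prop) (x0 : X) (J : Type) (lt : J -> J -> Prop)
    (s : J -> X) :
  (forall x, R x x) -> well_order lt ->
  (forall j, R x0 (s j)) -> (forall i j, lt i j -> R (s i) (s j)) ->
  (limit_order lt -> exists u, R x0 u /\ forall j, R (s j) u) ->
  exists u, R x0 u /\ forall j, R (s j) u.
Proof.
  intros Rr wo H0 Hs Hlim.
  destruct (classic (exists j : J, True)) as [Hne|He].
  - destruct (classic (forall i, exists j, lt i j)) as [Hl|Hm].
    + apply Hlim. split; auto.
    + apply not_all_ex_not in Hm as [m Hm]. exists (s m). split; auto.
      intros j. destruct wo as [_ [_ [tot _]]]. destruct (tot j m) as [H|[->|H]]; auto.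
      exfalso; eauto.
  - exists x0. split; auto. intros j. exfalso; eauto.
Qed.

(** While the recursion is being defined nothing guarantees a next member, so [F] picks one by
    [epsilon] and [good] is proved afterwards by induction. The point [x] in [good] bounds all
    earlier members, and the task [W i] is carried out between [x] and [s i]; this treats first,
    successor and limit stages alike. *)
Lemma transfinite_chain (X : Type) (R : X -> X -> Prop) (x0 : X)
    (I : Type) (lt : I -> I -> Prop) (W : I -> X -> X -> Prop) :
  (forall x, R x x) -> (forall x y z, R x y -> R y z -> R x z) -> well_order lt ->
  (forall i x, R x0 x -> exists y, R x y /\ W i x y) ->
  (forall (J : Type) (ltJ : J -> J -> Prop) (s : J -> X), limit_order ltJ -> card_le J I ->
     (forall j, R x0 (s j)) ->
     (forall i j, ltJ i j -> R (s i) (s j)) -> exists u, R x0 u /\ forall j, R (s j) u) ->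
  exists s : I -> X, (forall i, R x0 (s i)) /\ (forall i j, lt i j -> R (s i) (s j)) /\
    forall i, exists x, R x0 x /\ (forall j, lt j i -> R (s j) x) /\ R x (s i) /\ W i x (s i).
Proof.
  intros Rr Rt wo step lim.
  set (good := fun i (prev : forall j, lt j i -> X) y =>
    exists x, R x0 x /\ (forall j h, R (prev j h) x) /\ R x y /\ W i x y).
  assert (wf : well_founded lt) by apply wo.
  set (F := fun i prev => epsilon (inhabits x0) (good i prev)).
  set (s := Fix wf (fun _ => X) F).
  assert (sE : forall i, s i = epsilon (inhabits x0) (good i (fun j _ => s j))).
  { intros i. unfold s. rewrite Fix_eq; [reflexivity|].
    intros x f g E. assert (E' : f = g).
    { apply functional_extensionality_dep; intros y. apply functional_extensionality_dep; auto. }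
    rewrite E'; auto. }
  assert (Hg : forall i, good i (fun j _ => s j) (s i)).
  { intros i. induction (wf i) as [i _ IH].
    rewrite (sE i) at 1. apply epsilon_spec. unfold good.
    destruct (@chain_bound X R x0 {j | lt j i} (fun x y => lt (proj1_sig x) (proj1_sig y))
      (fun j => s (proj1_sig j))) as [u [Hu0 Hu]]; auto.
    - apply sub_well_order; auto.
    - intros [j h]. destruct (IH j h) as [x [H1 [_ [H2 _]]]]; cbn; eauto.
    - intros [j h] [k h'] l; cbn in *. destruct (IH k h') as [x [_ [H1 [H2 _]]]].
 apply (Rt _ x); auto.
    - intros Hl. apply lim with (1 := Hl).
      + exists (@proj1_sig _ _). intros; apply sig_ext; auto.
      + intros [j h]. destruct (IH j h) as [x [H1 [_ [H2 _]]]]; cbn; eauto.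
      + intros [j h] [k h'] l; cbn in *. destruct (IH k h') as [x [_ [H1 [H2 _]]]].
 apply (Rt _ x); auto.
    - destruct (step i u Hu0) as [y [Hy1 Hy2]]. exists y, u.
      split; [auto|split; [|auto]]. intros j h. exact (Hu (exist _ j h)). }
  exists s. split; [|split].
  - intros i. destruct (Hg i) as [x [H1 [_ [H2 _]]]]; eauto.
  - intros i j h. destruct (Hg j) as [x [_ [H1 [H2 _]]]]. apply (Rt _ x); auto.
  - intros i. destruct (Hg i) as [x [H0 [H1 [H2 H3]]]]. exists x. auto.
Qed.

(** The indices are tasks to be carried out in any order, so an arbitrary well-order of [I]
    serves. *)
Lemma transfinite_limit (X : Type) (R : X -> X -> Prop) (x0 : X)
    (I : Type) (W : I -> X -> X -> Prop) :
  (forall x, R x x) -> (forall x y z, R x y -> R y z -> R x z) ->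
  (forall i x, R x0 x -> exists y, R x y /\ W i x y) ->
  (forall (J : Type) (ltJ : J -> J -> Prop) (s : J -> X), limit_order ltJ -> card_le J I ->
     (forall j, R x0 (s j)) ->
     (forall i j, ltJ i j -> R (s i) (s j)) -> exists u, R x0 u /\ forall j, R (s j) u) ->
  exists u, R x0 u /\ forall i, exists x y, R x0 x /\ R x y /\ R y u /\ W i x y.
Proof.
  intros Rr Rt step lim. destruct (well_order_exists I) as [lt wo].
  destruct (@transfinite_chain X R x0 I lt W Rr Rt wo step lim) as [s [H0 [Hs HW]]].
  destruct (@chain_bound X R x0 I lt s) as [u [Hu0 Hu]]; auto.
  - intros Hl. apply lim with (1 := Hl); auto. apply card_le_refl.
  - exists u. split; auto. intros i. destruct (HW i) as [x [H1 [_ [H2 H3]]]].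
    exists x, (s i). auto.
Qed.

(* The order is X or its least initial segment not embeddable in A; its proper
   initial segments then embed in A, so every cofinal family is larger than A. *)
Lemma long_well_order (A X : Type) :
  card_le nat A -> card_le A X -> ~ card_le X A ->
  exists (I : Type) (lt : I -> I -> Prop), limit_order lt /\ card_le I X /\
    forall (B : Type) (b : B -> I), card_le B A -> exists i, forall x, lt (b x) i.
Proof.
  intros NA AX nXA. destruct (well_order_exists X) as [lt wo].
  assert (H : exists P : X -> Prop, ~ card_le {x | P x} A /\
     forall i, P i -> card_le {x | P x /\ lt x i} A).
  { destruct (classic (exists i, ~ card_le {x | lt x i} A)) as [[i Hi]|H].
    - destruct wo as [_ [tr [_ wf]]]. induction (wf i) as [i _ IH].
      destruct (classic (exists j, lt j i /\ ~ card_le {x | lt x j} A)) as [[j [h Hj]]|H].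
      + eapply IH; eauto.
      + exists (fun x => lt x i). split; auto. intros j h. apply NNPP. intros Hn.
        apply H. exists j. split; auto. intros Hc. apply Hn.
        eapply card_le_trans; [|exact Hc]. apply card_le_subset. tauto.
    - exists (fun _ => True). split.
      + intros Hc. apply nXA. eapply card_le_trans; [|exact Hc].
        exists (fun x => exist _ x Logic.I). intros x y E; inversion E; auto.
      + intros i _. apply NNPP. intros Hn. apply H. exists i. intros Hc. apply Hn.
        eapply card_le_trans; [|exact Hc]. apply card_le_subset. tauto. }
  destruct H as [P [H1 H2]].
  assert (Hb : forall (B : Type) (b : B -> {x | P x}), card_le B A ->
    exists i : {x | P x}, forall x, lt (proj1_sig (b x)) (proj1_sig i)).
  { intros B b HB. apply NNPP. intros Hn. apply H1.
    (* If no point bounded the family, the closed initial segments below its members would cover the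
       order, which would then have size at most [A]. *)
    apply (@card_le_bigcup A X B _ (fun y x => (P x /\ lt x (proj1_sig (b y))) \/
       (x = proj1_sig (b y)))); auto.
    - intros y. apply card_le_union; auto; [apply H2, proj2_sig|apply card_le_singleton; auto].
    - intros x Px. apply NNPP. intros Hx. apply Hn. exists (exist _ x Px).
      intros y. cbn. destruct wo as [_ [_ [tot _]]].
      destruct (tot (proj1_sig (b y)) x) as [h|[h|h]]; auto; exfalso; apply Hx; exists y; auto. }
  exists {x | P x}, (fun x y => lt (proj1_sig x) (proj1_sig y)).
  split; [split; [apply sub_well_order; auto|split]|split].
  (* A bound of the empty family shows that the order is nonempty; bounds of one-point families show
     that it has no last element. *)
  - destruct (Hb False (False_rect _)) as [i _]; [exists (False_rect _); tauto|]. eauto.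
  - intros i. destruct (Hb unit (fun _ => i)) as [j Hj].
    + destruct NA as [e _]. exists (fun _ => e 0). intros [] []; auto.
    + exists j. apply (Hj tt).
  - exists (@proj1_sig _ _). intros; apply sig_ext; auto.
  - exact Hb.
Qed.
(** * Isomorphisms and unions of structures *)

Section Structures.

Context {tau : vocab}.

Lemma iso_intro (T T' : Type) (h : T -> T') (M : model tau T) (N : model tau T') :
  (forall y, mdom N y <-> exists x, mdom M x /\ h x = y) ->
  (forall x y, mdom M x -> mdom M y -> h x = h y -> x = y) ->
  (forall f args, (forall i, mdom M (args i)) ->
     h (mfun M f args) = mfun N f (fun i => h (args i))) ->
  (forall r args, (forall i, mdom M (args i)) ->
     (mrel M r args <-> mrel N r (fun i => h (args i)))) ->
  isomorphism h M N.
Proof.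
  intros H1 H2 H3 H4. split; [split; [|auto]|].
  - intros x Mx. apply H1. eauto.
  - intros y Ny. apply H1. auto.
Qed.

(** The operations are conjugated by an inverse of [h] chosen with [epsilon]; its values outside the
    image are arbitrary and never matter. *)
Lemma push_exists (T T' : Type) (h : T -> T') (M : model tau T) :
  inhabited T -> (forall x y, mdom M x -> mdom M y -> h x = h y -> x = y) ->
  exists N : model tau T', isomorphism h M N.
Proof.
  intros iT inj.
  set (D := fun y => exists x, mdom M x /\ h x = y).
  set (inv := fun y => epsilon iT (fun x => mdom M x /\ h x = y)).
  assert (invP : forall y, D y -> mdom M (inv y) /\ h (inv y) = y).
  { intros y Dy. apply (epsilon_spec iT (fun x => mdom M x /\ h x = y)). exact Dy. }
  assert (invK : forall x, mdom M x -> inv (h x) = x).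
  { intros x Mx. destruct (invP (h x)) as [H1 H2]; [exists x; auto|]. apply inj; auto. }
  assert (invA : forall n (args : Fin n -> T), (forall i, mdom M (args i)) ->
     (fun i => inv (h (args i))) = args).
  { intros n args H. apply functional_extensionality. auto. }
  assert (cl : forall f args, (forall i, D (args i)) -> D (h (mfun M f (fun i => inv (args i))))).
  { intros f args H. exists (mfun M f (fun i => inv (args i))). split; auto.
    apply mclosed. intros i. apply invP. auto. }
  exists (@Model tau T' D (fun f args => h (mfun M f (fun i => inv (args i))))
    (fun r args => mrel M r (fun i => inv (args i))) cl).
  apply iso_intro; cbn; auto.
  - intros y. reflexivity.
  - intros f args H. rewrite invA; auto.
  - intros r args H. rewrite invA; auto. reflexivity.
Qed.

Lemma iso_dom (T T' : Type) (h : T -> T') (M : model tau T) (N : model tau T') :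
  isomorphism h M N -> image_dom h M N.
Proof.
  intros [[H1 _] H2] y. split; [apply H2|]. intros [x [Mx <-]]. auto.
Qed.

Lemma iso_inj (T T' : Type) (h : T -> T') (M : model tau T) (N : model tau T') :
  isomorphism h M N -> forall x y, mdom M x -> mdom M y -> h x = h y -> x = y.
Proof. intros [[_ [H _]] _]. exact H. Qed.

Lemma iso_card (T T' : Type) (h : T -> T') (M : model tau T) (N : model tau T') :
  isomorphism h M N -> card_eq (carrier M) (carrier N).
Proof.
  intros H. pose proof (iso_dom H) as D. pose proof (iso_inj H) as J.
  apply (@card_eq_rel _ _ (fun x y => h (proj1_sig x) = proj1_sig y)).
  - intros [x Mx]. exists (exist _ (h x) (proj1 (proj1 H) x Mx)). auto.
  - intros [y Ny]. destruct (proj1 (D y) Ny) as [x [Mx E]]. exists (exist _ x Mx). auto.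
  - intros [x Mx] [x' Mx'] b E E'. apply sig_ext. apply J; cbn in *; congruence.
  - intros. apply sig_ext. congruence.
Qed.

Lemma iso_comp (T T' T'' : Type) (h : T -> T') (g : T' -> T'')
    (M : model tau T) (N : model tau T') (P : model tau T'') :
  isomorphism h M N -> isomorphism g N P -> isomorphism (fun x => g (h x)) M P.
Proof.
  intros [[h1 [h2 [h3 h4]]] h5] [[g1 [g2 [g3 g4]]] g5].
  split; [split; [|split; [|split]]|]; auto.
  - intros f args H. rewrite h3, g3; auto.
  - intros r args H. rewrite h4, g4; auto. reflexivity.
  - intros z Pz. destruct (g5 z Pz) as [y [Ny <-]]. destruct (h5 y Ny) as [x [Mx <-]]. eauto.
Qed.

Lemma iso_ext (T T' : Type) (h h' : T -> T') (M : model tau T) (N : model tau T') :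
  (forall x, mdom M x -> h x = h' x) -> isomorphism h M N -> isomorphism h' M N.
Proof.
  intros E [[h1 [h2 [h3 h4]]] h5].
  assert (EA : forall n (args : Fin n -> T), (forall i, mdom M (args i)) ->
     (fun i => h' (args i)) = (fun i => h (args i))).
  { intros n args H. apply functional_extensionality. intros; symmetry; auto. }
  split; [split; [|split; [|split]]|].
  - intros x Mx. rewrite <- E; auto.
  - intros x y Mx My. rewrite <- !E; auto.
  - intros f args H. rewrite <- E, EA; auto. apply mclosed; auto.
  - intros r args H. rewrite EA; auto.
  - intros y Ny. destruct (h5 y Ny) as [x [Mx <-]]. exists x. split; auto. symmetry; auto.
Qed.

Lemma iso_inv (T T' : Type) (h : T -> T') (M : model tau T) (N : model tau T') :
  inhabited T -> isomorphism h M N ->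
  exists g, isomorphism g N M /\ (forall x, mdom M x -> g (h x) = x) /\
    (forall y, mdom N y -> h (g y) = y).
Proof.
  intros iT [[h1 [h2 [h3 h4]]] h5].
  set (g := fun y => epsilon iT (fun x => mdom M x /\ h x = y)).
  assert (gP : forall y, mdom N y -> mdom M (g y) /\ h (g y) = y).
  { intros y Ny. apply (epsilon_spec iT (fun x => mdom M x /\ h x = y)). auto. }
  assert (gK : forall x, mdom M x -> g (h x) = x).
  { intros x Mx. destruct (gP (h x)); auto. }
  assert (gA : forall n (args : Fin n -> T'), (forall i, mdom N (args i)) ->
     (fun i => h (g (args i))) = args).
  { intros n args H. apply functional_extensionality. intros i. apply gP. auto. }
  exists g. split; [|split]; auto; [|apply gP].
  split; [split; [|split; [|split]]|].
  - apply gP.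
  - intros x y Nx Ny E. apply gP in Nx, Ny. destruct Nx, Ny. congruence.
  - intros f args H. apply h2.
    + apply gP. apply mclosed; auto.
    + apply mclosed. intros i. apply gP; auto.
    + rewrite h3; [|intros i; apply gP; auto]. rewrite gA; auto.
      apply gP. apply mclosed; auto.
  - intros r args H. rewrite h4; [|intros i; apply gP; auto]. rewrite gA; auto. reflexivity.
  - intros x Mx. exists (h x). auto.
Qed.

Lemma iso_substr (T T' : Type) (h : T -> T') (M N : model tau T) (M' N' : model tau T') :
  substr M N -> isomorphism h M M' -> isomorphism h N N' -> substr M' N'.
Proof.
  intros [s1 [s2 s3]] HM HN.
  pose proof (iso_dom HM) as D.
  assert (L : forall n (args : Fin n -> T'), (forall i, mdom M' (args i)) ->
    exists a : Fin n -> T, (forall i, mdom M (a i)) /\ args = fun i => h (a i)).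
  { intros n args H.
    destruct (choice (fun i x => mdom M x /\ h x = args i)) as [a Ha].
    - intros i. apply D. auto.
    - exists a. split; [apply Ha|]. apply functional_extensionality. intros i.
      symmetry; apply Ha. }
  destruct HM as [[h1 [h2 [h3 h4]]] h5], HN as [[g1 [g2 [g3 g4]]] g5].
  split; [|split].
  - intros y Hy. apply D in Hy as [x [Mx <-]]. auto.
  - intros f args H. destruct (L _ _ H) as [a [Ha ->]].
    rewrite <- h3, <- g3, s2; auto.
  - intros r args H. destruct (L _ _ H) as [a [Ha ->]].
    rewrite <- h4, <- g4, s3; auto. reflexivity.
Qed.

(** Arities are finite, so the largest of the indices needed for the single arguments serves for all
    of them. *)
Lemma directed_args (I T : Type) (lt : I -> I -> Prop) (D : I -> T -> Prop) :
  limit_order lt -> (forall i j x, lt i j -> D i x -> D j x) ->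
  forall n (args : Fin n -> T), (forall i, exists j, D j (args i)) ->
  exists j, forall i, D j (args i).
Proof.
  intros [[_ [_ [tot _]]] [[i0 _] _]] mono.
  induction n as [|n IH]; intros args H.
  - exists i0. intros [i h]. lia.
  - destruct (IH (fun i : Fin n => args (exist _ (proj1_sig i)
      (Nat.lt_lt_succ_r _ _ (proj2_sig i))))) as [j Hj]; [intros; apply H|].
    destruct (H (exist _ n (Nat.lt_succ_diag_r n))) as [k Hk].
    assert (Q : forall m, (m = j \/ lt j m) -> (m = k \/ lt k m) -> forall i, D m (args i)).
    { intros m mj mk [i h]. destruct (Nat.eq_dec i n) as [->|ne].
      - replace (exist _ n h) with (exist (fun i => i < S n) n (Nat.lt_succ_diag_r n))
          by (apply sig_ext; auto).
        destruct mk as [->|mk]; eauto.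
      - assert (h' : i < n) by lia. specialize (Hj (exist _ i h')). cbn in Hj.
        replace (exist _ i h) with (exist (fun i => i < S n) i (Nat.lt_lt_succ_r i n h'))
          by (apply sig_ext; auto).
        destruct mj as [->|mj]; eauto. }
    destruct (tot j k) as [h|[h|h]].
    + exists k. apply Q; auto.
    + subst. exists k. apply Q; auto.
    + exists j. apply Q; auto.
Qed.

Lemma substr_refl (T : Type) (M : model tau T) : substr M M.
Proof. split; [|split]; auto. intros; reflexivity. Qed.

(** A function symbol takes its value from any member containing the arguments; members are
    comparable, so the choice does not affect the value. *)
Lemma union_exists (I T : Type) (lt : I -> I -> Prop) (M : I -> model tau T) :
  limit_order lt -> (forall i j, lt i j -> substr (M i) (M j)) ->
  exists U, is_union M U.
Proof.
  intros lo inc.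
  pose proof (directed_args (fun i x => mdom (M i) x) lo
    (fun i j x h => proj1 (inc i j h) x)) as dir.
  assert (cmp : forall i j, substr (M i) (M j) \/ substr (M j) (M i)).
  { intros i j. destruct lo as [[_ [_ [tot _]]] _].
    destruct (tot i j) as [h|[->|h]]; auto. left; apply substr_refl. }
  destruct lo as [_ [[i0 _] _]].
  set (F := fun f args => epsilon (inhabits (mfun (M i0) f args))
     (fun y => exists i, (forall k, mdom (M i) (args k)) /\ y = mfun (M i) f args)).
  assert (FE : forall i f args, (forall k, mdom (M i) (args k)) -> F f args = mfun (M i) f args).
  { intros i f args H.
    destruct (epsilon_spec (inhabits (mfun (M i0) f args))
     (fun y => exists i, (forall k, mdom (M i) (args k)) /\ y = mfun (M i) f args))
     as [j [H1 H2]]; [eauto|]. fold (F f args) in H2. rewrite H2.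
    destruct (cmp i j) as [h|h]; [symmetry|]; apply h; auto. }
  assert (cl : forall f args, (forall k, exists i, mdom (M i) (args k)) ->
     exists i, mdom (M i) (F f args)).
  { intros f args H. destruct (dir _ _ H) as [i Hi]. exists i. rewrite (FE i); auto.
    apply mclosed; auto. }
  exists (@Model tau T (fun x => exists i, mdom (M i) x) F
    (fun r args => exists i, (forall k, mdom (M i) (args k)) /\ mrel (M i) r args) cl).
  split; [reflexivity|]. intros i. split; [|split]; cbn; eauto.
  - intros f args H. symmetry. auto.
  - intros r args H. split; [eauto|]. intros [j [H1 H2]].
    destruct (cmp i j) as [h|h]; apply h in H2; auto.
Qed.

Lemma union_iso (I T T' : Type) (lt : I -> I -> Prop) (M : I -> model tau T)
    (H : I -> model tau T') (U : model tau T) (V : model tau T') (h : T -> T') :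
  limit_order lt -> (forall i j, lt i j -> substr (M i) (M j)) ->
  is_union M U -> is_union H V -> (forall i, isomorphism h (M i) (H i)) ->
  isomorphism h U V.
Proof.
  intros lo inc [U1 U2] [V1 V2] iso.
  pose proof (directed_args (fun i x => mdom (M i) x) lo
    (fun i j x h => proj1 (inc i j h) x)) as dir.
  assert (dir' : forall n (args : Fin n -> T), (forall k, mdom U (args k)) ->
     exists i, forall k, mdom (M i) (args k)).
  { intros n args Ha. apply dir. intros k. apply U1. auto. }
  apply iso_intro.
  - intros y. rewrite V1. split.
    + intros [i Hi]. apply (iso_dom (iso i)) in Hi as [x [Mx E]]. exists x.
      split; auto. apply (U2 i). auto.
    + intros [x [Ux E]]. apply U1 in Ux as [i Mx]. exists i. apply (iso_dom (iso i)). eauto.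
  - intros x y Ux Uy. apply U1 in Ux as [i Mx], Uy as [j My].
    destruct lo as [[_ [_ [tot _]]] _]. destruct (tot i j) as [l|[l|l]].
    + apply (iso_inj (iso j)); auto. apply (inc _ _ l); auto.
    + subst j. apply (iso_inj (iso i)); auto.
    + apply (iso_inj (iso i)); auto. apply (inc _ _ l); auto.
  - intros f args Ha. destruct (dir' _ _ Ha) as [i Hi].
    destruct (iso i) as [[h1 [_ [h3 _]]] _].
    rewrite <- (proj1 (proj2 (U2 i))), <- (proj1 (proj2 (V2 i))); auto.
  - intros f args Ha. destruct (dir' _ _ Ha) as [i Hi].
    destruct (iso i) as [[h1 [_ [_ h4]]] _].
    rewrite <- (proj2 (proj2 (U2 i))), <- (proj2 (proj2 (V2 i))); auto.
Qed.

End Structures.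

(** * Abstract classes *)

Unset Strict Implicit.

Section AbstractClass.

Context {tau : vocab} {K : aclass tau}.
Hypothesis AC : is_abstract_class K.
Hypothesis NE : forall T (M : model tau T), Kmem K M -> exists x, mdom M x.

Lemma Kmem_iso (T T' : Type) (h : T -> T') (M : model tau T) (N : model tau T') :
  isomorphism h M N -> Kmem K M -> Kmem K N.
Proof. intros. eapply (proj1 AC); eauto. Qed.

Lemma Kle_mem (T : Type) (M N : model tau T) : Kle K M N -> Kmem K M /\ Kmem K N.
Proof. apply (proj2 AC). Qed.

Lemma Kle_refl (T : Type) (M : model tau T) : Kmem K M -> Kle K M M.
Proof. apply (proj2 (proj2 AC)). Qed.

Lemma Kle_trans (T : Type) (M N P : model tau T) : Kle K M N -> Kle K N P -> Kle K M P.
Proof. apply (proj2 (proj2 (proj2 AC))). Qed.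

Lemma Kle_substr (T : Type) (M N : model tau T) : Kle K M N -> substr M N.
Proof. apply (proj2 (proj2 (proj2 (proj2 (proj2 AC))))). Qed.

Lemma Kle_dom (T : Type) (M N : model tau T) : Kle K M N -> forall x, mdom M x -> mdom N x.
Proof. intros H. apply (Kle_substr H). Qed.

Lemma Kmem_inhabited (T : Type) (M : model tau T) : Kmem K M -> inhabited T.
Proof. intros H. destruct (NE H) as [x _]. exact (inhabits x). Qed.

Lemma Kle_iso (T T' : Type) (h : T -> T') (M N : model tau T) (M' N' : model tau T') :
  Kle K M N -> isomorphism h M M' -> isomorphism h N N' -> Kle K M' N'.
Proof.
  intros L HM HN. eapply (proj2 (proj2 (proj2 (proj2 (proj2 (proj2 AC)))))); eauto.
  - apply iso_dom; auto.
  - eapply iso_substr; eauto. apply Kle_substr; auto.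
Qed.

Lemma Kle_push (T T' : Type) (h : T -> T') (M N : model tau T) (N' : model tau T') :
  Kle K M N -> isomorphism h N N' -> exists M', isomorphism h M M' /\ Kle K M' N'.
Proof.
  intros L HN. destruct (@push_exists tau T T' h M) as [M' HM].
  - apply (@Kmem_inhabited T M). apply (Kle_mem L).
  - intros x y Mx My. apply (iso_inj HN); apply (Kle_dom L); auto.
  - exists M'. split; auto. apply (Kle_iso L HM HN).
Qed.

(** Working form of [Kemb]: an isomorphism onto a K-submodel of the target is easier to compose and
    to transport than the separate clauses on images and substructures. *)
Lemma Kemb_iff (T T' : Type) (h : T -> T') (M : model tau T) (N : model tau T') :
  Kemb K h M N <-> Kmem K M /\ exists M', isomorphism h M M' /\ Kle K M' N.
Proof.
  split.
  - intros [HM [[h1 [h2 [h3 h4]]] [M' [D [[s1 [s2 s3]] L]]]]]. split; auto. exists M'. split; auto.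
    assert (hM : forall x, mdom M x -> mdom M' (h x)) by (intros x Mx; apply D; eauto).
    apply iso_intro; auto.
    + intros f args H. rewrite h3, s2; auto.
    + intros r args H. rewrite h4, s3; auto. reflexivity.
  - intros [HM [M' [iso L]]]. pose proof (Kle_substr L) as [s1 [s2 s3]].
    pose proof iso as [[h1 [h2 [h3 h4]]] h5].
    split; [auto|split].
    + split; [|split; [|split]]; auto.
      * intros f args H. rewrite h3, s2; auto.
      * intros r args H. rewrite h4, s3; auto. reflexivity.
    + exists M'. split; [|split]; auto. apply iso_dom; auto. apply Kle_substr; auto.
Qed.

Lemma Kemb_mem (T T' : Type) (h : T -> T') (M : model tau T) (N : model tau T') :
  Kemb K h M N -> Kmem K M /\ Kmem K N.
Proof. intros H. apply Kemb_iff in H as [HM [M' [_ L]]]. split; auto. apply (Kle_mem L). Qed.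

Lemma Kemb_dom (T T' : Type) (h : T -> T') (M : model tau T) (N : model tau T') :
  Kemb K h M N -> forall x, mdom M x -> mdom N (h x).
Proof. intros [_ [[H _] _]]. exact H. Qed.

Lemma Kemb_inj (T T' : Type) (h : T -> T') (M : model tau T) (N : model tau T') :
  Kemb K h M N -> forall x y, mdom M x -> mdom M y -> h x = h y -> x = y.
Proof. intros [_ [[_ [H _]] _]]. exact H. Qed.

Lemma Kemb_card_le (T T' : Type) (h : T -> T') (M : model tau T) (N : model tau T') :
  Kemb K h M N -> card_le (carrier M) (carrier N).
Proof.
  intros H. exists (fun x => exist _ (h (proj1_sig x)) (Kemb_dom H (proj2_sig x))).
  intros [x Mx] [y My] E. apply sig_ext. cbn in *. inversion E. apply (Kemb_inj H); auto.
Qed.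

Lemma iso_Kemb (T T' : Type) (h : T -> T') (M : model tau T) (N : model tau T') :
  Kmem K M -> isomorphism h M N -> Kemb K h M N.
Proof.
  intros HM iso. apply Kemb_iff. split; auto. exists N. split; auto.
  apply Kle_refl. eapply Kmem_iso; eauto.
Qed.

Lemma iso_id (T : Type) (M : model tau T) : isomorphism (fun x => x) M M.
Proof.
  apply iso_intro; auto.
  - intros y. split; [eauto|intros [x [H <-]]; auto].
  - intros; reflexivity.
Qed.

Lemma Kle_Kemb (T : Type) (M N : model tau T) : Kle K M N -> Kemb K (fun x => x) M N.
Proof.
  intros L. apply Kemb_iff. split; [apply (Kle_mem L)|]. exists M. split; auto. apply iso_id.
Qed.

Lemma Kemb_comp (T T' T'' : Type) (h : T -> T') (g : T' -> T'')
    (M : model tau T) (N : model tau T') (P : model tau T'') :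
  Kemb K h M N -> Kemb K g N P -> Kemb K (fun x => g (h x)) M P.
Proof.
  intros H1 H2. apply Kemb_iff in H1 as [HM [M' [iso L]]].
  apply Kemb_iff in H2 as [HN [N' [iso' L']]]. apply Kemb_iff. split; auto.
  destruct (Kle_push L iso') as [M'' [iso'' L'']].
  exists M''. split; [eapply iso_comp; eauto|]. eapply Kle_trans; eauto.
Qed.

Lemma Kemb_restrict (T T' : Type) (h : T -> T') (M0 M : model tau T) (N : model tau T') :
  Kle K M0 M -> Kemb K h M N -> Kemb K h M0 N.
Proof. intros L H. exact (Kemb_comp (Kle_Kemb L) H). Qed.

Lemma Kemb_extend (T T' : Type) (h : T -> T') (M : model tau T) (N P : model tau T') :
  Kemb K h M N -> Kle K N P -> Kemb K h M P.
Proof. intros H L. exact (Kemb_comp H (Kle_Kemb L)). Qed.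

(** Turns an embedding into a literal extension inside the ambient type of [M]: points of the image
    go back to their preimages, all others to fresh points outside [M]. *)
Lemma Kemb_inclusion (T T' : Type) (h : T -> T') (M : model tau T) (N : model tau T') :
  Kemb K h M N -> card_le (carrier N) {y | ~ mdom M y} ->
  exists (k : T' -> T) (N' : model tau T),
    isomorphism k N N' /\ Kle K M N' /\ forall x, mdom M x -> k (h x) = x.
Proof.
  intros H Hc. pose proof (Kemb_mem H) as [HM HN].
  pose proof (Kmem_inhabited HM) as iT. pose proof (Kmem_inhabited HN) as iT'.
  pose proof (Kemb_inj H) as hinj.
  destruct (card_le_fun (mdom N) _ iT Hc) as [j [j1 j2]].
  set (inv := fun y => epsilon iT (fun x => mdom M x /\ h x = y)).
  assert (invK : forall x, mdom M x -> inv (h x) = x).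
  { intros x Mx. destruct (epsilon_spec iT (fun z => mdom M z /\ h z = h x)); eauto. }
  set (k := fun y => if excluded_middle_informative (exists x, mdom M x /\ h x = y)
    then inv y else j y).
  assert (kh : forall x, mdom M x -> k (h x) = x).
  { intros x Mx. unfold k. destruct (excluded_middle_informative _) as [_|n]; auto.
    destruct n; eauto. }
  assert (kj : forall y, mdom N y -> (exists x, mdom M x /\ h x = y) \/ k y = j y).
  { intros y Ny. unfold k. destruct (excluded_middle_informative _); auto. }
  destruct (@push_exists tau T' T k N iT') as [N' iso].
  { intros x y Nx Ny E.
    destruct (kj x Nx) as [[a [Ma <-]]|Ea], (kj y Ny) as [[b [Mb <-]]|Eb].
    - rewrite !kh in E; auto. congruence.
    - rewrite kh, Eb in E; auto. destruct (j1 y); auto. congruence.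
    - rewrite kh, Ea in E; auto. destruct (j1 x); auto. congruence.
    - apply j2; congruence. }
  exists k, N'. split; [auto|split; [|auto]].
  (* On the image [M'] of [M] the map [k] inverts [h], so it carries the pair [M'], [N] to the pair
     [M], [N']. *)
  apply Kemb_iff in H as [_ [M' [iso' L]]].
  apply (Kle_iso (h := k) L); auto.
  apply (@iso_inv tau _ _ h M M' iT) in iso' as [g [ig [g1 g2]]].
  apply (@iso_ext _ _ _ g); auto. intros y My.
  rewrite <- (g2 y My) at 2. symmetry. apply kh. apply ig; auto.
Qed.

End AbstractClass.

Arguments Kemb_iff {tau K} AC {T T'}.

(** * Amalgamation of K-embeddings across ambient types *)

Section Amalgamation.

Context {tau : vocab} {K : aclass tau}.
Hypothesis AC : is_abstract_class K.
Hypothesis NE : forall T (M : model tau T), Kmem K M -> exists x, mdom M x.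
Hypothesis AP : amalgamation K.

(** The amalgamation hypothesis concerns literal extensions in one ambient type. A copy of [M0] in
    the left summand of [T0 + (T1 + T2)] leaves room to turn both [M1] and [M2] into extensions of
    it there. *)
Lemma amalgamate (T0 T1 T2 : Type) (M0 : model tau T0) (M1 : model tau T1) (M2 : model tau T2)
    (f1 : T0 -> T1) (f2 : T0 -> T2) :
  Kemb K f1 M0 M1 -> Kemb K f2 M0 M2 ->
  exists T (N : model tau T) (g1 : T1 -> T) (g2 : T2 -> T),
    Kemb K g1 M1 N /\ Kemb K g2 M2 N /\ forall x, mdom M0 x -> g1 (f1 x) = g2 (f2 x).
Proof.
  intros H1 H2. pose proof (Kemb_mem AC H1) as [HM0 HM1]. pose proof (Kemb_mem AC H2) as [_ HM2].
  pose proof (Kmem_inhabited NE HM0) as iT.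
  destruct (@push_exists tau T0 (T0 + (T1 + T2)) inl M0 iT) as [M0' iso].
  { intros x y _ _ E. inversion E; auto. }
  destruct (iso_inv iT iso) as [p [ip [p1 p2]]].
  pose proof (Kmem_iso AC iso HM0) as HM0'.
  assert (D : forall z, ~ mdom M0' (inr z)).
  { intros z Hz. apply (iso_dom iso) in Hz as [x [_ E]]. discriminate. }
  destruct (Kemb_inclusion AC NE (Kemb_comp AC NE (iso_Kemb AC HM0' ip) H1)) as [k1 [M1' [i1 [l1 e1]]]].
  { exists (fun x => exist _ (inr (inl (proj1_sig x))) (D _)).
    intros x y E. inversion E. apply sig_ext; auto. }
  destruct (Kemb_inclusion AC NE (Kemb_comp AC NE (iso_Kemb AC HM0' ip) H2)) as [k2 [M2' [i2 [l2 e2]]]].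
  { exists (fun x => exist _ (inr (inr (proj1_sig x))) (D _)).
    intros x y E. inversion E. apply sig_ext; auto. }
  destruct (AP l1 l2) as [T [N [F1 [F2 [G1 [G2 E]]]]]].
  exists T, N, (fun x => F1 (k1 x)), (fun x => F2 (k2 x)).
  split; [|split].
  - exact (Kemb_comp AC NE (iso_Kemb AC HM1 i1) G1).
  - exact (Kemb_comp AC NE (iso_Kemb AC HM2 i2) G2).
  - intros x Mx.
    assert (Mx' : mdom M0' (inl x)) by (apply iso; auto).
    pose proof (e1 _ Mx') as E1. pose proof (e2 _ Mx') as E2. cbn in E1, E2.
    rewrite p1 in E1, E2; auto. rewrite E1, E2. auto.
Qed.

End Amalgamation.

(** * Coherence, submodels of prescribed size, unions of chains *)

Section Fragmented.

Context {tau : vocab} {K : aclass tau} {L : Type}.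
Hypothesis AC : is_abstract_class K.
Hypothesis NE : forall T (M : model tau T), Kmem K M -> exists x, mdom M x.
Hypothesis CO : coherence K.
Hypothesis RC : restricted_chain K.
Hypothesis SM : smoothness K.
Hypothesis LSP : LS_prop K L.

(** The image of [M] is a K-submodel of [N] lying inside [P], so coherence applies. *)
Lemma Kemb_into (T T' : Type) (h : T -> T') (M : model tau T) (N P : model tau T') :
  Kemb K h M N -> Kle K P N -> (forall x, mdom M x -> mdom P (h x)) -> Kemb K h M P.
Proof.
  intros H LP Hd. apply (Kemb_iff AC) in H as [HM [M' [iso LM]]].
  apply (Kemb_iff AC). split; auto. exists M'. split; auto.
  apply (@CO _ M' P N); auto. intros y Hy. apply (iso_dom iso) in Hy as [x [Mx <-]]. auto.
Qed.

(** By coherence [k] embeds [P] into the image of [M]; composing with the inverse of [h] gives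
    [g]. *)
Lemma Kemb_factor (T T' T'' : Type) (h : T -> T') (k : T'' -> T')
    (M : model tau T) (N : model tau T') (P : model tau T'') :
  Kemb K h M N -> Kemb K k P N ->
  (forall x, mdom P x -> exists y, mdom M y /\ h y = k x) ->
  exists g, Kemb K g P M /\ forall x, mdom P x -> h (g x) = k x.
Proof.
  intros HM HP Hd. apply (Kemb_iff AC) in HM as [KM [M' [iso LM]]].
  destruct (iso_inv (Kmem_inhabited NE KM) iso) as [p [ip [p1 p2]]].
  assert (HP' : Kemb K k P M').
  { apply (@Kemb_into _ _ _ _ N); auto. intros x Px. destruct (Hd x Px) as [y [My <-]].
    apply iso; auto. }
  exists (fun x => p (k x)). split.
  - apply (Kemb_comp AC NE HP'). apply (iso_Kemb AC); auto. apply (Kemb_mem AC HP').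
  - intros x Px. apply p2. apply (Kemb_dom HP'); auto.
Qed.

Lemma LS_nat : card_le nat L.
Proof.
  eapply card_le_trans; [|apply (proj1 LSP)]. exists inr. intros x y E. inversion E; auto.
Qed.

(** Throwing [S] further points [B] into the generating set makes the size at least [S]; as [S]
    absorbs [L], it is no larger. *)
Lemma LS_submodel (S T : Type) (N : model tau T) (A : T -> Prop) :
  Kmem K N -> (forall x, A x -> mdom N x) ->
  card_le L S -> card_le {x | A x} S -> card_le S (carrier N) ->
  exists M, Kle K M N /\ (forall x, A x -> mdom M x) /\ card_eq (carrier M) S.
Proof.
  intros HN HA LS AS [e He].
  assert (NS : card_le nat S) by (eapply card_le_trans; [apply LS_nat|auto]).
  set (B := fun x => exists s, proj1_sig (e s) = x).
  assert (BS : card_le S {x | B x}).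
  { exists (fun s => exist _ (proj1_sig (e s)) (ex_intro _ s eq_refl)).
    intros x y E. inversion E as [E']. apply sig_ext in E'. auto. }
  destruct (proj2 LSP T N (fun x => A x \/ B x)) as [M [L1 [L2 L3]]]; auto.
  - intros x [Ax|[s <-]]; auto. apply proj2_sig.
  - exists M. split; [auto|split; [auto|]]. apply cantor_bernstein.
    + eapply card_le_trans; [exact L3|]. eapply card_le_trans; [|apply (card_le_sum_idem NS)].
      apply card_le_sum; auto. apply card_le_union; auto. apply card_le_image.
    + eapply card_le_trans; [exact BS|]. apply card_le_subset. auto.
Qed.

Lemma chain_substr (T I : Type) (lt : I -> I -> Prop) (s : I -> model tau T) :
  increasing K lt s -> forall i j, lt i j -> substr (s i) (s j).
Proof. intros inc i j l. apply (Kle_substr AC). auto. Qed.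

(** The union of at most [S] members of size [S] has size [S], as the restricted axiom requires. The
    axiom compares only the first member with the union, so for the member [s i] it is applied to
    the tail starting at [i]. *)
Lemma chain_union (S T I : Type) (lt : I -> I -> Prop) (s : I -> model tau T) (V : model tau T) :
  card_le nat S -> limit_order lt -> card_le I S -> increasing K lt s ->
  (forall i, card_eq (carrier (s i)) S) -> is_union s V ->
  Kmem K V /\ card_eq (carrier V) S /\ forall i, Kle K (s i) V.
Proof.
  intros NS lo IS inc cs UV.
  assert (cV : card_eq (carrier V) S).
  { pose proof (proj1 (proj2 lo)) as [i0 _]. apply cantor_bernstein.
    - apply (@card_le_bigcup S T I _ (fun i x => mdom (s i) x)); auto.
      + intros i. apply card_eq_le, cs.
      + intros x Vx. apply UV; auto.
    - eapply card_le_trans; [apply card_eq_le, card_eq_sym, (cs i0)|].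
      apply card_le_subset. apply (proj2 UV i0). }
  assert (ceq : forall i, card_eq (carrier (s i)) (carrier V)).
  { intros i. eapply card_eq_trans; [apply cs|apply card_eq_sym; auto]. }
  split; [|split; auto].
  - pose proof (proj1 (proj2 lo)) as [i0 _].
    apply (@RC T I lt s V lo inc UV). exists i0. auto.
  - intros i. set (P := fun j => j = i \/ lt i j).
    pose proof (proj1 lo) as [irr [tr [tot wf]]].
    refine (proj2 (@RC T {j | P j} (fun x y => lt (proj1_sig x) (proj1_sig y))
      (fun j => s (proj1_sig j)) V _ _ _ _) (exist _ i (or_introl eq_refl)) _).
    + split; [apply sub_well_order; apply lo|split].
      * exists (exist _ i (or_introl eq_refl)). auto.
      * intros [j Pj]. destruct (proj2 (proj2 lo) j) as [k jk].
        assert (Pk : P k) by (right; destruct Pj as [->|Pj]; eauto).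
        exists (exist _ k Pk). auto.
    + intros [j Pj] [k Pk] l. apply inc. exact l.
    + split; [|intros [j Pj]; apply UV].
      intros x. split.
      * intros Vx. apply UV in Vx as [j sj].
        destruct (tot i j) as [l|[<-|l]].
        -- exists (exist _ j (or_intror l)). auto.
        -- exists (exist _ i (or_introl eq_refl)). auto.
        -- exists (exist _ i (or_introl eq_refl)). cbn. apply (Kle_dom AC (inc _ _ l)); auto.
      * intros [[j Pj] sj]. apply UV. exists j. exact sj.
    + exists (exist _ i (or_introl eq_refl)). apply ceq.
    + cbn. intros [j Pj] l. cbn in l. destruct Pj as [->|Pj].
      * exact (irr _ l).
      * exact (irr i (tr _ _ _ Pj l)).
Qed.

(** The members need only increase as sets: all are K-submodels of [N], and coherence supplies the
    order between them. *)
Lemma smooth_union (T I : Type) (lt : I -> I -> Prop) (s : I -> model tau T) (V N : model tau T) :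
  limit_order lt -> (forall i j, lt i j -> forall x, mdom (s i) x -> mdom (s j) x) ->
  (forall i, Kle K (s i) N) -> is_union s V -> Kle K V N /\ forall i, Kle K (s i) V.
Proof.
  intros lo inc LN UV.
  assert (KN : Kmem K N).
  { pose proof (proj1 (proj2 lo)) as [i0 _]. apply (Kle_mem AC (LN i0)). }
  assert (LV : Kle K V N).
  { apply (@SM T I lt s V N); auto. intros i j l. apply (@CO T (s i) (s j) N); auto.
    apply inc; auto. }
  split; auto. intros i. apply (@CO T (s i) V N); auto. apply UV.
Qed.

End Fragmented.
(** * Saturation and homogeneity *)

Section Saturation.

Context {tau : vocab} {K : aclass tau} {L : Type}.
Hypothesis AC : is_abstract_class K.
Hypothesis NE : forall T (M : model tau T), Kmem K M -> exists x, mdom M x.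
Hypothesis CO : coherence K.
Hypothesis RC : restricted_chain K.
Hypothesis SM : smoothness K.
Hypothesis LSP : LS_prop K L.
Hypothesis AP : amalgamation K.

(** When [M'] extends [M], this says that for some [c] in [M'] the triple of [b] and [N] is
    atomically equivalent over [M] to the triple of [c] and [M']. *)
Definition realized (T T1 : Type) (M : model tau T) (f : T -> T1) (N : model tau T1) (b : T1)
    (M' : model tau T) : Prop :=
  exists T3 (N3 : model tau T3) (g1 : T1 -> T3) (g2 : T -> T3) (c : T),
    Kemb K g1 N N3 /\ Kemb K g2 M' N3 /\ mdom M' c /\ g1 b = g2 c /\
    forall x, mdom M x -> g1 (f x) = g2 x.

Definition realizes_all (T : Type) (M M' : model tau T) : Prop :=
  forall (t : gtriple K M), realized M (gf t) (gN t) (gb t) M'.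

Lemma realized_extend (T T1 : Type) (M : model tau T) (f : T -> T1) (N : model tau T1) (b : T1)
    (M' M'' : model tau T) :
  Kle K M M' -> Kle K M' M'' -> realized M f N b M' -> realized M f N b M''.
Proof.
  intros l l' [T3 [N3 [g1 [g2 [c [G1 [G2 [Mc [E1 E2]]]]]]]]].
  destruct (amalgamate AC NE AP G2 (Kle_Kemb AC l')) as [T4 [N4 [h1 [h2 [H1 [H2 E]]]]]].
  exists T4, N4, (fun x => h1 (g1 x)), h2, c. split; [|split; [|split; [|split]]]; auto.
  - exact (Kemb_comp AC NE G1 H1).
  - apply (Kle_dom AC l'); auto.
  - rewrite E1. auto.
  - intros x Mx. rewrite E2; auto. apply E. apply (Kle_dom AC l); auto.
Qed.

(** The two amalgams share the model of [p]; amalgamating them over it identifies [c] with the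
    element of [q]. This is transitivity of the atomic relation under amalgamation. *)
Lemma realized_gatomic (T : Type) (M M' : model tau T) (p q : gtriple K M) :
  gatomic p q -> realized M (gf p) (gN p) (gb p) M' -> realized M (gf q) (gN q) (gb q) M'.
Proof.
  intros [T4 [N4 [k1 [k2 [K1 [K2 [E3 E4]]]]]]] [T3 [N3 [g1 [g2 [c [G1 [G2 [Mc [E1 E2]]]]]]]]].
  destruct (amalgamate AC NE AP G1 K1) as [T5 [N5 [u [v [U [V E]]]]]].
  exists T5, N5, (fun x => v (k2 x)), (fun x => u (g2 x)), c.
  split; [|split; [|split; [|split]]]; auto.
  - exact (Kemb_comp AC NE K2 V).
  - exact (Kemb_comp AC NE G2 U).
  - rewrite <- E4, <- E, E1; auto. apply gb_in.
  - intros x Mx. rewrite <- E3, <- E, E2; auto. apply (Kemb_dom (gf_K p)); auto.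
Qed.

Lemma realized_gequiv (T : Type) (M M' : model tau T) (p q : gtriple K M) :
  gequiv p q -> realized M (gf p) (gN p) (gb p) M' -> realized M (gf q) (gN q) (gb q) M'.
Proof. intros H. induction H; auto. apply realized_gatomic; auto. Qed.

(** A type over [M0] extends to one over [M]: amalgamate its model with [M] over [M0]. *)
Lemma realizes_all_restrict (T : Type) (M0 M M' : model tau T) :
  Kle K M0 M -> realizes_all M M' -> realizes_all M0 M'.
Proof.
  intros l H [T1 N f b Hf Nb]. cbn.
  destruct (amalgamate AC NE AP Hf (Kle_Kemb AC l)) as [T2 [N1 [h1 [h2 [H1 [H2 E]]]]]].
  destruct (H (@GTriple tau K _ _ _ _ _ _ H2 (Kemb_dom H1 Nb))) as [T3 [N3 [g1 [g2 [c [G1 [G2 [Mc [E1 E2]]]]]]]]].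
  cbn in *.
  exists T3, N3, (fun x => g1 (h1 x)), g2, c. split; [|split; [|split; [|split]]]; auto.
  - exact (Kemb_comp AC NE H1 G1).
  - intros x Mx. rewrite E; auto. apply E2. apply (Kle_dom AC l); auto.
Qed.

(** The amalgam of [N] and [M] over [M0] contains the wanted element. It is cut down to size [S],
    keeping [M] and that element, and moved back into [U] as a literal extension of [M]. *)
Lemma realize_one (S U : Type) (M0 M : model tau U) (t : gtriple K M0) :
  card_le L S -> roomy S U -> Kle K M0 M -> card_eq (carrier M) S ->
  exists M', Kle K M M' /\ card_eq (carrier M') S /\ realized M0 (gf t) (gN t) (gb t) M'.
Proof.
  intros LS room l cM. destruct t as [T1 N f b Hf Nb]; cbn.
  assert (NS : card_le nat S) by (eapply card_le_trans; [apply (LS_nat LSP)|auto]).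
  destruct (amalgamate AC NE AP Hf (Kle_Kemb AC l)) as [T3 [N3 [g1 [g2 [G1 [G2 E]]]]]].
  destruct (@LS_submodel tau K L LSP S T3 N3
    (fun x => (exists m : carrier M, g2 (proj1_sig m) = x) \/ x = g1 b)) as [M2 [l2 [A2 c2]]]; auto.
  - apply (Kemb_mem AC G1).
  - intros x [[[m Mm] <-]| ->]; [apply (Kemb_dom G2); auto|apply (Kemb_dom G1); auto].
  - apply card_le_union; auto.
    + eapply card_le_trans; [apply card_le_image|apply card_eq_le; auto].
    + apply card_le_singleton; auto.
  - eapply card_le_trans; [apply card_eq_le, card_eq_sym; exact cM|]. apply (Kemb_card_le G2).
  - assert (G2' : Kemb K g2 M M2).
    { apply (Kemb_into AC CO G2 l2). intros x Mx. apply A2. left. exists (exist _ x Mx). auto. }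
    assert (M2b : mdom M2 (g1 b)) by auto.
    destruct (Kemb_inclusion AC NE G2') as [k [M' [ik [l' kK]]]].
    { eapply card_le_trans; [apply card_eq_le; exact c2|]. apply room. apply card_eq_le, cM. }
    destruct (iso_inv (Kmem_inhabited NE (proj1 (Kle_mem AC l2))) ik) as [p [ip [p1 p2]]].
    exists M'. split; [auto|split].
    + eapply card_eq_trans; [apply card_eq_sym, (iso_card ik)|auto].
    + exists T3, N3, g1, p, (k (g1 b)). split; [|split; [|split; [|split]]]; auto.
      * apply (Kemb_extend AC NE (N := M2)); auto. apply (iso_Kemb AC); auto.
        apply (Kle_mem AC l').
      * apply ik; auto.
      * symmetry; auto.
      * intros x Mx. rewrite E; auto. pose proof (Kle_dom AC l Mx) as Mx'.
        rewrite <- (kK x Mx') at 2. symmetry. apply p1. apply (Kemb_dom G2'); auto.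
Qed.

(** The size is fixed so that [chain_union] bounds chains of limit length. *)
Definition ext_model (S U : Type) (M : model tau U) : Type :=
  {M' : model tau U | Kle K M M' /\ card_eq (carrier M') S}.

Lemma ext_model_limit (S U J : Type) (M : model tau U) (lt : J -> J -> Prop)
    (s : J -> ext_model S M) :
  card_le nat S -> limit_order lt -> card_le J S ->
  (forall i j, lt i j -> Kle K (proj1_sig (s i)) (proj1_sig (s j))) ->
  exists V : ext_model S M, is_union (fun i => proj1_sig (s i)) (proj1_sig V) /\
    forall i, Kle K (proj1_sig (s i)) (proj1_sig V).
Proof.
  intros NS lo JS inc.
  destruct (@union_exists tau J U lt (fun i => proj1_sig (s i)) lo) as [V UV].
  { intros i j h. apply (Kle_substr AC). auto. }
  destruct (@chain_union tau K AC RC S U J lt (fun i => proj1_sig (s i)) V) as [KV [cV lV]]; auto.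
  { intros i. apply (proj2_sig (s i)). }
  assert (HV : Kle K M V /\ card_eq (carrier V) S).
  { split; auto. pose proof (proj1 (proj2 lo)) as [i0 _].
    apply (Kle_trans AC (N := proj1_sig (s i0))); auto. apply (proj2_sig (s i0)). }
  exists (exist _ V HV). auto.
Qed.

(** By stability at most [S] representatives suffice, so they are treated one by one along a chain
    of length at most [S]; equivalent triples follow by [realized_gequiv]. *)
Lemma realize_all (S U : Type) (M : model tau U) :
  card_le L S -> roomy S U -> Kmem K M -> card_eq (carrier M) S -> stable K S ->
  exists M', Kle K M M' /\ card_eq (carrier M') S /\ realizes_all M M'.
Proof.
  intros LS room HM cM st.
  assert (NS : card_le nat S) by (eapply card_le_trans; [apply (LS_nat LSP)|auto]).
  destruct (st U M HM cM) as [I [fam [IS Hfam]]].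
  destruct (@transfinite_limit (ext_model S M)
    (fun P Q => Kle K (proj1_sig P) (proj1_sig Q))
    (exist _ M (conj (Kle_refl AC HM) cM)) I
    (fun i _ Q => realized M (gf (fam i)) (gN (fam i)) (gb (fam i)) (proj1_sig Q)))
    as [[V [lV cV]] [_ HV]].
  - intros [P [lP cP]]. cbn. apply (Kle_refl AC). apply (Kle_mem AC lP).
  - intros P Q R. apply (Kle_trans AC).
  - intros i [P [lP cP]] _.
    destruct (realize_one (fam i) LS room lP cP) as [Q [lQ [cQ rQ]]].
    assert (HQ : Kle K M Q /\ card_eq (carrier Q) S) by (split; auto; apply (Kle_trans AC lP lQ)).
    exists (exist _ Q HQ). auto.
  - intros J lt s lo JI _ inc.
    destruct (ext_model_limit (s := s) NS lo (card_le_trans JI IS) inc) as [V [_ lV]].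
    exists V. split; auto. apply (proj2_sig V).
  - exists V. split; [auto|split; [auto|]]. intros t. destruct (Hfam t) as [i Hi].
    apply (realized_gequiv Hi). destruct (HV i) as [x [[Y [lY cY]] [_ [_ [YV rY]]]]].
    cbn in *. apply (realized_extend lY YV rY).
Qed.

Lemma saturated_exists (A S U : Type) (M : model tau U) :
  card_le nat A -> card_le A S -> ~ card_le S A ->
  card_le L S -> roomy S U -> Kmem K M -> card_eq (carrier M) S -> stable K S ->
  exists N : model tau U, Kmem K N /\ card_eq (carrier N) S /\
    forall M0, Kle K M0 N -> card_eq (carrier M0) A -> realizes_all M0 N.
Proof.
  intros NA AS nSA LS room HM cM st.
  assert (NS : card_le nat S) by (eapply card_le_trans; eauto).
  destruct (long_well_order NA AS nSA) as [I [lt [lo [IS cof]]]].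
  destruct (@transfinite_chain (ext_model S M)
    (fun P Q => Kle K (proj1_sig P) (proj1_sig Q))
    (exist _ M (conj (Kle_refl AC HM) cM)) I lt
    (fun i P Q => realizes_all (proj1_sig P) (proj1_sig Q)))
    as [s [_ [inc Hs]]].
  - intros [P [lP cP]]. cbn. apply (Kle_refl AC). apply (Kle_mem AC lP).
  - intros P Q R. apply (Kle_trans AC).
  - apply lo.
  - intros i [P [lP cP]] _.
    destruct (realize_all LS room (proj2 (Kle_mem AC lP)) cP st) as [Q [lQ [cQ rQ]]].
    assert (HQ : Kle K M Q /\ card_eq (carrier Q) S) by (split; auto; apply (Kle_trans AC lP lQ)).
    exists (exist _ Q HQ). auto.
  - intros J ltJ t loJ JI _ incJ.
    destruct (ext_model_limit (s := t) NS loJ (card_le_trans JI IS) incJ) as [V [_ lV]].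
    exists V. split; auto. apply (proj2_sig V).
  - destruct (ext_model_limit (s := s) NS lo IS inc) as [[V [lV cV]] [UV sV]]. cbn in UV, sV.
    exists V. split; [apply (Kle_mem AC lV)|split; [auto|]].
    intros M0 l0 c0.
    destruct (choice (fun (x : carrier M0) i => mdom (proj1_sig (s i)) (proj1_sig x))) as [b Hb].
    { intros [x Mx]. apply UV. apply (Kle_dom AC l0 Mx). }
    (* Each of the [A] points of [M0] appears at some stage, and the long order bounds these stages
       by one index [i]. *)
    destruct (cof _ b (card_eq_le c0)) as [i Hi].
    assert (l0i : Kle K M0 (proj1_sig (s i))).
    { apply (@CO U M0 _ V); auto. intros x Mx.
      apply (Kle_dom AC (inc _ _ (Hi (exist _ x Mx)))). apply (Hb (exist _ x Mx)). }
    (* At a later stage [j], the model [P] lies above [s i], hence above [M0], and [s j] realizes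
       all types over [P]. *)
    destruct (proj2 (proj2 lo) i) as [j ij].
    destruct (Hs j) as [P [_ [H1 [H2 H3]]]].
    pose proof (Kle_trans AC l0i (H1 i ij)) as l0P.
    intros t. apply (realized_extend (Kle_trans AC l0P H2) (sV j)).
    apply (realizes_all_restrict l0P H3).
Qed.

(** The map goes from a submodel of the saturated model [N] into an extension [N'] of the model to
    be embedded, not the other way. A realization comes with an amalgam, so capturing a new point
    may enlarge the codomain; once the image covers the original model, the map is inverted
    there. *)
Definition partial_map_ok (A U : Type) (N : model tau U)
    (p : model tau U * model tau U * (U -> U)) : Prop :=
  let '(M, N', h) := p in
  Kle K M N /\ card_eq (carrier M) A /\ card_eq (carrier N') A /\ Kemb K h M N'.

Definition partial_map_le (U : Type) (p q : model tau U * model tau U * (U -> U)) : Prop :=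
  Kle K (fst (fst p)) (fst (fst q)) /\ Kle K (snd (fst p)) (snd (fst q)) /\
  forall x, mdom (fst (fst p)) x -> snd p x = snd q x.

Lemma partial_map_limit (A U J : Type) (N : model tau U) (lt : J -> J -> Prop)
    (s : J -> model tau U * model tau U * (U -> U)) :
  card_le nat A -> limit_order lt -> card_le J A ->
  (forall i, partial_map_ok A N (s i)) ->
  (forall i j, lt i j -> partial_map_le (s i) (s j)) ->
  exists u, partial_map_ok A N u /\ forall i, partial_map_le (s i) u.
Proof.
  intros NA lo JA ok inc.
  set (M := fun i => fst (fst (s i))). set (P := fun i => snd (fst (s i))).
  set (h := fun i => snd (s i)).
  assert (ok' : forall i, Kle K (M i) N /\ card_eq (carrier (M i)) A /\
     card_eq (carrier (P i)) A /\ Kemb K (h i) (M i) (P i)).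
  { intros i. specialize (ok i). unfold M, P, h. destruct (s i) as [[? ?] ?]. exact ok. }
  assert (incM : increasing K lt M) by (intros i j l; apply (inc i j l)).
  assert (incP : increasing K lt P) by (intros i j l; apply (inc i j l)).
  destruct (union_exists M lo (chain_substr AC incM)) as [VM UM].
  destruct (union_exists P lo (chain_substr AC incP)) as [VP UP].
  destruct (@chain_union tau K AC RC A U J lt M VM) as [KM [cM lM]]; auto.
  { apply ok'. }
  destruct (@chain_union tau K AC RC A U J lt P VP) as [KP [cP lP]]; auto.
  { apply ok'. }
  destruct (@smooth_union tau K AC CO SM U J lt M VM N) as [lVN _]; auto.
  { intros i j l x. apply (Kle_dom AC (incM _ _ l)). }
  { apply ok'. }
  (* The maps agree wherever they overlap; off the union of the domains [g] is the identity, an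
     arbitrary default. *)
  destruct (choice (fun x y => forall i, mdom (M i) x -> h i x = y)) as [g Hg].
  { intros x. destruct (classic (exists i, mdom (M i) x)) as [[i Mi]|n].
    - exists (h i x). intros j Mj. destruct lo as [[_ [_ [tot _]]] _].
      destruct (tot i j) as [l|[<-|l]]; auto; [symmetry|]; apply (inc _ _ l); auto.
    - exists x. intros i Mi. destruct n; eauto. }
  (* That [g] is a K-embedding is seen on images: the images [H i] form a chain inside [VP], and
     smoothness puts their union below [VP]. *)
  destruct (choice (fun i H => isomorphism g (M i) H /\ Kle K H (P i))) as [H HH].
  { intros i. destruct (ok' i) as [_ [_ [_ hi]]].
    apply (Kemb_iff AC) in hi as [_ [H [iso l]]]. exists H. split; auto.
    eapply iso_ext; [|exact iso]. cbn. intros x Mx. apply Hg; auto. }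
  assert (incH : forall i j, lt i j -> forall y, mdom (H i) y -> mdom (H j) y).
  { intros i j l y Hy. apply (iso_dom (proj1 (HH i))) in Hy as [x [Mx <-]].
    apply (proj1 (HH j)). apply (Kle_dom AC (incM _ _ l) Mx). }
  assert (lH : forall i, Kle K (H i) VP).
  { intros i. apply (Kle_trans AC (proj2 (HH i))). auto. }
  destruct (@union_exists tau J U lt H lo) as [VH UH].
  { intros i j l. apply (Kle_substr AC). apply (@CO U (H i) (H j) VP); auto. apply incH; auto. }
  destruct (@smooth_union tau K AC CO SM U J lt H VH VP) as [lVH _]; auto.
  assert (Hg' : Kemb K g VM VP).
  { apply (Kemb_iff AC). split; auto. exists VH. split; auto.
    apply (@union_iso tau J U U lt M H VM VH g); auto; [apply (chain_substr AC incM)|].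
    intros i. apply HH. }
  exists (VM, VP, g). split; [split; auto|].
  intros i. split; [apply lM|split; [apply lP|]]. cbn. intros x Mx. apply (Hg x i Mx).
Qed.

(** Through [h], the element [a] has a type over [M], realized by some [c] in [N]. A submodel [M2]
    of [N] containing [M] and [c], together with [N'], maps into a size [A] part of the amalgam;
    moving that part back so that it extends [N'] literally sends [c] to [a]. *)
Lemma partial_map_step (A U : Type) (N M N' : model tau U) (h : U -> U) (a : U) :
  card_le L A -> roomy A U -> Kmem K N ->
  (forall M0, Kle K M0 N -> card_eq (carrier M0) A -> realizes_all M0 N) ->
  partial_map_ok A N (M, N', h) -> mdom N' a ->
  exists q, partial_map_ok A N q /\ partial_map_le (M, N', h) q /\
    exists c, mdom (fst (fst q)) c /\ snd q c = a.
Proof.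
  intros LA room KN sat [lM [cM [cN' Hh]]] N'a.
  assert (NA : card_le nat A) by (eapply card_le_trans; [apply (LS_nat LSP)|auto]).
  destruct (sat M lM cM (@GTriple tau K _ _ _ _ _ _ Hh N'a)) as [T3 [N3 [g1 [g2 [c [G1 [G2 [Nc [E1 E2]]]]]]]]].
  cbn in *.
  destruct (@LS_submodel tau K L LSP A U N (fun x => mdom M x \/ x = c)) as [M2 [l2 [A2 c2]]]; auto.
  { intros x [Mx| ->]; auto. apply (Kle_dom AC lM Mx). }
  { apply card_le_union; auto; [apply card_eq_le, cM|apply card_le_singleton; auto]. }
  { eapply card_le_trans; [apply card_eq_le, card_eq_sym; exact cM|].
    apply (Kemb_card_le (Kle_Kemb AC lM)). }
  assert (lM2 : Kle K M M2) by (apply (@CO U M M2 N); auto).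
  pose proof (Kemb_restrict AC NE l2 G2) as G2'.
  destruct (@LS_submodel tau K L LSP A T3 N3 (fun x => (exists m : carrier N', g1 (proj1_sig m) = x)
     \/ (exists m : carrier M2, g2 (proj1_sig m) = x))) as [N4 [l4 [A4 c4]]]; auto.
  { apply (Kemb_mem AC G1). }
  { intros x [[[m Mm] <-]|[[m Mm] <-]]; [apply (Kemb_dom G1)|apply (Kemb_dom G2')]; auto. }
  { apply card_le_union; auto; (eapply card_le_trans; [apply card_le_image|apply card_eq_le; auto]). }
  { eapply card_le_trans; [apply card_eq_le, card_eq_sym; exact cM|].
    apply (Kemb_card_le (Kemb_comp AC NE Hh G1)). }
  assert (G1' : Kemb K g1 N' N4).
  { apply (Kemb_into AC CO G1 l4). intros x Nx. apply A4. left. exists (exist _ x Nx). auto. }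
  assert (G2'' : Kemb K g2 M2 N4).
  { apply (Kemb_into AC CO G2' l4). intros x Mx. apply A4. right. exists (exist _ x Mx). auto. }
  destruct (Kemb_inclusion AC NE G1') as [k [N5 [ik [l5 kK]]]].
  { eapply card_le_trans; [apply card_eq_le; exact c4|]. apply room. apply card_eq_le, cN'. }
  exists (M2, N5, fun x => k (g2 x)). split; [|split].
  - split; [auto|split; [auto|split]].
    + eapply card_eq_trans; [apply card_eq_sym, (iso_card ik)|auto].
    + apply (Kemb_comp AC NE G2''). apply (iso_Kemb AC); auto. apply (Kle_mem AC l4).
  - split; [auto|split; [auto|]]. cbn. intros x Mx. rewrite <- E2; auto. symmetry.
    apply kK. apply (Kemb_dom Hh Mx).
  - cbn. exists c. split; auto. rewrite <- E1. apply kK. auto.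
Qed.

(** The tasks are the elements of [N0]. When all are done, the image of [h] covers [N0], and
    [Kemb_factor] inverts [h] on it. *)
Lemma saturated_embedding (A U : Type) (N M0 N0 : model tau U) :
  card_le L A -> roomy A U -> Kmem K N ->
  (forall M0, Kle K M0 N -> card_eq (carrier M0) A -> realizes_all M0 N) ->
  Kle K M0 N -> Kle K M0 N0 -> card_eq (carrier M0) A -> card_eq (carrier N0) A ->
  exists g : U -> U, Kemb K g N0 N /\ forall x, mdom M0 x -> g x = x.
Proof.
  intros LA room KN sat l0 l0' c0 c0'.
  assert (NA : card_le nat A) by (eapply card_le_trans; [apply (LS_nat LSP)|auto]).
  assert (H0 : partial_map_ok A N (M0, N0, fun x => x)).
  { split; [auto|split; [auto|split; [auto|]]]. apply (Kle_Kemb AC l0'). }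
  destruct (@transfinite_limit {p | partial_map_ok A N p}
    (fun p q => partial_map_le (proj1_sig p) (proj1_sig q)) (exist _ _ H0) (carrier N0)
    (fun a _ q => exists c, mdom (fst (fst (proj1_sig q))) c /\ snd (proj1_sig q) c = proj1_sig a))
    as [[[[M1 N1] h] [lM1 [cM1 [cN1 Hh]]]] [Hu Hall]].
  - intros [[[M1 N1] h] [l [c1 [c2 H]]]]. split; [|split]; cbn; auto; apply (Kle_refl AC).
    + apply (Kle_mem AC l).
    + apply (Kemb_mem AC H).
  - intros p q r [H1 [H2 H3]] [H4 [H5 H6]].
    split; [apply (Kle_trans AC H1 H4)|split; [apply (Kle_trans AC H2 H5)|]].
    intros x Mx. rewrite H3; auto. apply H6. apply (Kle_dom AC H1 Mx).
  - intros [a Na] [[[M1 N1] h] ok] [_ [l _]]. cbn in *.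
    destruct (partial_map_step LA room KN sat ok (Kle_dom AC l Na)) as [q [Hq1 [Hq2 Hq3]]].
    exists (exist _ q Hq1). auto.
  - intros J lt s lo JI H0s inc.
    destruct (@partial_map_limit A U J N lt (fun i => proj1_sig (s i)) NA lo) as [u [Hu1 Hu2]]; auto.
    + apply (card_le_trans JI). apply card_eq_le, c0'.
    + intros i. apply proj2_sig.
    + exists (exist _ u Hu1). split; auto. cbn.
      pose proof (proj1 (proj2 lo)) as [i0 _].
      destruct (H0s i0) as [H1 [H2 H3]], (Hu2 i0) as [H4 [H5 H6]].
      split; [apply (Kle_trans AC H1 H4)|split; [apply (Kle_trans AC H2 H5)|]].
      intros x Mx. rewrite H3; auto. apply H6. apply (Kle_dom AC H1 Mx).
  - destruct Hu as [lM [lN hid]]. cbn in lM, lN, hid.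
    destruct (@Kemb_factor tau K AC NE CO U U U h (fun x => x) M1 N1 N0 Hh) as [g [Hg gK]].
    + apply (Kle_Kemb AC lN).
    + intros x Nx. destruct (Hall (exist _ x Nx)) as [y [z [_ [_ [[lz [_ Ez]] [c [zc E]]]]]]].
      cbn in *. exists c. split; [apply (Kle_dom AC lz zc)|]. rewrite <- Ez; auto.
    + exists g. split; [exact (Kemb_extend AC NE Hg lM1)|].
      (* Both [g x] and [x] are sent to [x] by [h], which is the identity on [M0]; injectivity
         finishes. *)
      intros x Mx. pose proof (Kle_dom AC l0' Mx) as Nx. apply (Kemb_inj Hh).
      * apply (Kemb_dom Hg Nx).
      * apply (Kle_dom AC lM Mx).
      * rewrite gK; auto.
Qed.

End Saturation.

Theorem theorem3p4 (tau : vocab) (K : aclass tau) (L : Type) :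
  fragmented_AEC K ->
  is_LS K L ->
  amalgamation K ->
  (forall T (M : model tau T), Kmem K M -> ~ card_lt (carrier M) L) ->
  (forall lam : Type, in_dom K lam -> categorical K lam /\ stable K lam) ->
  forall T (M : model tau T), Kmem K M -> card_lt L (carrier M) ->
    model_homogeneous K M.
Proof.
  intros [AC [_ [CO [RC SM]]]] [LSP _] AP big dom T M HM _ M0 T' N0 h l0 Hh [cNM nMN].
  (* Cardinals being comparable, the absence of models below [L] puts [L] below every model; in
     particular all models are infinite. *)
  assert (LK : forall T (M : model tau T), Kmem K M -> card_le L (carrier M)).
  { intros T1 M1 H1. destruct (card_le_total L (carrier M1)) as [|H]; auto.
    apply NNPP. intros n. apply (big T1 M1 H1). split; auto. }
  assert (NE : forall T (M : model tau T), Kmem K M -> exists x, mdom M x).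
  { intros T1 M1 H1. destruct (LK T1 M1 H1) as [f _]. destruct (LS_nat LSP) as [e _].
    exists (proj1_sig (f (e 0))). apply proj2_sig. }
  set (S := carrier M) in *. set (A := carrier N0) in *. set (U := S -> Prop).
  pose proof (Kemb_mem AC Hh) as [KM0 KN0].
  assert (LA : card_le L A) by (apply LK; auto).
  assert (LS : card_le L S) by (apply LK; auto).
  assert (NA : card_le nat A) by (eapply card_le_trans; [apply (LS_nat LSP)|auto]).
  assert (NS : card_le nat S) by (eapply card_le_trans; [apply (LS_nat LSP)|auto]).
  assert (refl : forall B, card_eq B B) by (intros B; exists (fun x => x); split; eauto).
  pose proof (power_roomy NS) as roomS. fold U in roomS.
  assert (roomA : roomy A U).
  { intros D HD. eapply card_le_trans; [exact cNM|]. apply roomS.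
    eapply card_le_trans; [exact HD|exact cNM]. }
  destruct (dom S) as [[_ cat] st]; [exists T, M; auto|].
  pose proof (Kmem_inhabited NE HM) as iT.
  (* Points of [M] become singletons in [S -> Prop]; this copy is the starting model for the
     saturated one. *)
  destruct (@push_exists tau T U (fun x s => proj1_sig s = x) M iT) as [MU iMU].
  { intros x y Mx My E. apply (f_equal (fun f => f (exist _ x Mx))) in E. cbn in E.
    rewrite <- E. auto. }
  destruct (@saturated_exists tau K L AC NE CO RC LSP AP A S U MU) as [N [KN [cN sat]]]; auto.
  { apply (Kmem_iso AC iMU HM). }
  { apply card_eq_sym. apply (iso_card iMU). }
  destruct (cat T U M N) as [k ik]; auto.
  destruct (iso_inv iT ik) as [k' [ik' [k1 k2]]].
  (* [M0] may be smaller than [A], while saturation concerns submodels of size exactly [A]. So [M0]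
     is enlarged to [M1] inside [M], and [N0] is replaced by a size [A] part [N2] of its amalgam
     with [M1] over [M0]. *)
  destruct (@LS_submodel tau K L LSP A T M (mdom M0)) as [M1 [l1 [A1 c1]]]; auto.
  { apply (Kle_dom AC l0). }
  { apply (Kemb_card_le Hh). }
  assert (l01 : Kle K M0 M1) by (apply (CO T M0 M1 M); auto).
  destruct (amalgamate AC NE AP (Kle_Kemb AC l01) Hh) as [T1 [N1 [f1 [f2 [F1 [F2 E]]]]]].
  destruct (@LS_submodel tau K L LSP A T1 N1 (fun x => (exists m : carrier M1, f1 (proj1_sig m) = x)
     \/ (exists m : carrier N0, f2 (proj1_sig m) = x))) as [N2 [l2 [A2 c2]]]; auto.
  { apply (Kemb_mem AC F1). }
  { intros x [[[m Mm] <-]|[[m Mm] <-]]; [apply (Kemb_dom F1)|apply (Kemb_dom F2)]; auto. }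
  { apply card_le_union; auto; (eapply card_le_trans; [apply card_le_image|apply card_eq_le; auto]). }
  { apply (Kemb_card_le F2). }
  assert (F1' : Kemb K f1 M1 N2).
  { apply (Kemb_into AC CO F1 l2). intros x Mx. apply A2. left. exists (exist _ x Mx). auto. }
  assert (F2' : Kemb K f2 N0 N2).
  { apply (Kemb_into AC CO F2 l2). intros x Mx. apply A2. right. exists (exist _ x Mx). auto. }
  (* The isomorphism [k] places [M1] inside [N] as [M1'], and [N2] is moved into [U] as a literal
     extension [N3] of [M1']. *)
  destruct (Kle_push AC NE l1 ik) as [M1' [ik1 l1']].
  destruct (iso_inv iT ik1) as [p [ip [p1 p2]]].
  pose proof (card_eq_trans (card_eq_sym (iso_card ik1)) c1) as c1'.
  destruct (Kemb_inclusion AC NE (Kemb_comp AC NE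
    (iso_Kemb AC (proj1 (Kle_mem AC l1')) ip) F1')) as [r [N3 [ir [l3 rK]]]].
  { eapply card_le_trans; [apply card_eq_le; exact c2|]. apply roomA. apply card_eq_le, c1'. }
  destruct (@saturated_embedding tau K L AC NE CO RC SM LSP A U N M1' N3)
    as [g [Hg gid]]; auto.
  { eapply card_eq_trans; [apply card_eq_sym, (iso_card ir)|auto]. }
  exists (fun x => k' (g (r (f2 x)))). split.
  - pose proof (Kemb_comp AC NE F2' (iso_Kemb AC (proj2 (Kemb_mem AC F2')) ir)) as H1.
    exact (Kemb_comp AC NE (Kemb_comp AC NE H1 Hg) (iso_Kemb AC KN ik')).
  - intros x Mx. pose proof (Kle_dom AC l01 Mx) as Mx1.
    rewrite <- E; auto. cbn.
    (* For [x] in [M0], the map [r] sends its image in the amalgam to [k x], which [g] fixes and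
       [k'] returns to [x]. *)
    assert (Mkx : mdom M1' (k x)) by (apply ik1; auto).
    pose proof (rK _ Mkx) as Ex. cbn in Ex. rewrite p1 in Ex; auto.
    rewrite Ex, gid; auto. apply k1. apply (Kle_dom AC l0 Mx).
Qed.
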